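(* In the normal-cell setting described in the context, fix one piece with codimension $d\ge1$, suppress its index, and suppose its cells are cones $\mathsf A(p)=C(p)$; let $S(p):=C(p)\cap\mathbb S^{d-1}$ and let $\sigma$ be surface measure on $\mathbb S^{d-1}$. For $r>0$, $\theta\in S(p)$ write $F(p,r,\theta):=F(p,r\theta)$ and $\widehat J(p,r,\theta):=J(p,r\theta)$, and assume that $$\mathcal I(z,p)=\int_{S(p)}\int_0^\varepsilon a(F(p,r,\theta))\widehat J(p,r,\theta)e^{-zf(F(p,r,\theta))}r^{d-1}\,dr\,d\sigma(\theta),$$ where $\widehat J(p,r,\theta)\to1$ uniformly in $(p,\theta)$ as $r\downarrow0$. Assume there are measurable functions $c(p,\theta),\alpha(p,\theta)$ with $$0<c_-\le c(p,\theta)\le c_+<\infty,\qquad 0<\alpha_-\le\alpha(p,\theta)\le\alpha_+<\infty,$$ and $$f(F(p,r,\theta))-f_0=c(p,\theta)r^{\alpha(p,\theta)}\bigl(1+\mathcal R_{\mathrm{rad}}(p,r,\theta)\bigr),$$ where $\mathcal R_{\mathrm{rad}}(p,0,\theta)=0$, $\mathcal R_{\mathrm{rad}}\to0$ uniformly in $(p,\theta)$ as $r\downarrow0$, and $\varepsilon$ is such that $|\mathcal R_{\mathrm{rad}}|\le\delta_0<1$ throughout the polar coordinate domain. Assume also that $a(F(p,r,\theta))\widehat J(p,r,\theta)$ is uniformly bounded and converges to $a(p)$ uniformly in $(p,\theta)$ as $r\downarrow0$. Define $$\mathcal I_{\mathrm{rad}}(z,p,\theta):=\int_0^\varepsilon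 a(F(p,r,\theta))\widehat J(p,r,\theta)e^{-zf(F(p,r,\theta))}r^{d-1}\,dr .$$ Then, as $z\to\infty$, $$\sup_{p,\theta}\left|e^{zf_0}z^{d/\alpha(p,\theta)}\mathcal I_{\mathrm{rad}}(z,p,\theta)-\frac{a(p)}{\alpha(p,\theta)}c(p,\theta)^{-d/\alpha(p,\theta)}\Gamma\!\left(\frac d{\alpha(p,\theta)}\right)\right|\longrightarrow0 .$$ Consequently, $$\mathcal I(z,p)=e^{-zf_0}\int_{S(p)}z^{-d/\alpha(p,\theta)}\bigl(\mathcal L_{\mathrm{rad}}(p,\theta)+\delta_z^{\mathrm{rad}}(p,\theta)\bigr)\,d\sigma(\theta),$$ where $\mathcal L_{\mathrm{rad}}(p,\theta):=\frac{a(p)}{\alpha(p,\theta)}c(p,\theta)^{-d/\alpha(p,\theta)}\Gamma\bigl(d/\alpha(p,\theta)\bigr)$ and $\sup_{p,\theta}|\delta_z^{\mathrm{rad}}(p,\theta)|\to0$.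
   Context: Setting. $(N,g)$ is a $C^2$ Riemannian manifold of dimension $n$ with Riemannian volume measure $\mathrm{dvol}_g$; $f:N\to\mathbb R$ is continuous and bounded below; $a:N\to\mathbb C$ is measurable; $f_0:=\inf_Nf$; $M:=\{x\in N:f(x)=f_0\}$ is nonempty and compact. $\mathcal T_\varepsilon(M):=\{x:\operatorname{dist}_g(x,M)<\varepsilon\}$; $B_r$ is the open Euclidean ball of radius $r$ at $0$. $M=\bigsqcup_{j=0}^{\ell}\Sigma_j$ is a disjoint union of finitely many $C^2$ embedded strata, $\Sigma_j$ a (possibly empty or disconnected) $j$-dimensional submanifold. Normal-cell decomposition. There are $\varepsilon>0$ and a finite index set $\mathcal A$, and for each $\alpha\in\mathcal A$: a Borel set $P_\alpha\subset\Sigma_{j_\alpha}$ of finite $j_\alpha$-dimensional Riemannian volume, with $M=\bigsqcup_\alpha P_\alpha$; an open neighborhood $U_\alpha$ of $P_\alpha$ in $\Sigma_{j_\alpha}$; the codimension $d_\alpha:=n-j_\alpha$; a $C^1$ map $F_\alpha:U_\alpha\times B_\varepsilon\to N$ with $F_\alpha(p,0)=p$; and sets (cells) $\mathsf A_\alpha(p)\subset\mathbb R^{d_\alpha}$, $p\in P_\alpha$, with measurable graph. With $\mathfrak D_\alpha(\varepsilon):=\{(p,s):p\in P_\alpha,\ s\in\mathsf A_\alpha(p)\cap B_\varepsilon\}$, the sets $F_\alpha(\mathfrak D_\alpha(\varepsilon))$ are pairwise disjoint up to null sets and cover $\mathcal T_\varepsilon(M)$ up to a null set, and there are measurable $J_\alpha:\mathfrak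 D_\alpha(\varepsilon)\to(0,\infty)$ such that for every nonnegative measurable $h$ $$\int_{F_\alpha(\mathfrak D_\alpha(\varepsilon))}h\,\mathrm{dvol}_g=\int_{P_\alpha}\int_{\mathsf A_\alpha(p)\cap B_\varepsilon}h(F_\alpha(p,s))J_\alpha(p,s)\,ds\,\mathrm{dvol}_{P_\alpha}(p).$$ For $z>0$ put $\mathcal I_\alpha(z,p):=\int_{\mathsf A_\alpha(p)\cap B_\varepsilon}a(F_\alpha(p,s))J_\alpha(p,s)e^{-zf(F_\alpha(p,s))}\,ds$. (In the claim the index $\alpha$ of the piece is suppressed and $\alpha(p,\theta)$ denotes the radial order.) Suprema over $(p,\theta)$ are over the measurable graph $\{(p,\theta):p\in P,\theta\in S(p)\}$. For $d=1$, $\sigma$ is counting measure on $\mathbb S^0=\{\pm1\}$. $\Gamma$ is the Euler gamma function. *)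

(* Defs.v *)
From HB Require Import structures.
From mathcomp Require Import all_boot all_order all_algebra.
From mathcomp Require Import complex ring lra.
From mathcomp Require Import all_classical all_reals all_analysis measurable_realfun.
Set Implicit Arguments. Unset Strict Implicit. Unset Printing Implicit Defensive.
Import Order.TTheory GRing.Theory Num.Theory numFieldNormedType.Exports.
Local Open Scope classical_set_scope. Local Open Scope ring_scope.

Definition borel (T : ptopologicalType) := g_sigma_algebraType (@open T).
HB.instance Definition _ (T : ptopologicalType) := Measurable.on (borel T).

Lemma close_aux (R : realType) (q u y k e : R) : k < e / 2 ->
  q - k < y -> y < q + k -> u - k < q -> q < u + k -> `|u - y| < e.
Proof. by move=> *; rewrite ltr_norml; apply/andP; split; lra. Qed.

Lemma rV_borelP d (T : measurableType d) (R : realType) n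
    (f : T -> borel 'rV[R]_n) :
  (forall i, measurable_fun setT (fun x => (f x : 'rV[R]_n) 0 i)) ->
  measurable_fun setT f.
Proof.
move=> mf; apply: measurability => [//|_ [U oU <-]].
pose box (qk : 'rV[rat]_n * nat) : set 'rV[R]_n :=
  [set y | forall i, y 0 i \in `](ratr (qk.1 0 i) - qk.2.+1%:R^-1),
                                 (ratr (qk.1 0 i) + qk.2.+1%:R^-1)[].
have -> : setT `&` f @^-1` U =
    \bigcup_(qk in [set qk | box qk `<=` U])
      (\bigcap_(i : 'I_n) ((fun x => (f x : 'rV[R]_n) 0 i) @^-1`
       `](ratr (qk.1 0 i) - qk.2.+1%:R^-1), (ratr (qk.1 0 i) + qk.2.+1%:R^-1)[)).
  rewrite setTI; apply/seteqP; split => [x /= Ux|x [qk /= bU xq]]; last first.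
    by apply: bU => i; exact: (xq i).
  have := oU; rewrite openE => /(_ _ Ux)/nbhs_ballP[e /= e0 xeU].
  have [k ke] : exists k : nat, k.+1%:R^-1 < e / 2.
    exists (Num.truncn (e / 2)^-1).
    rewrite invf_plt ?posrE// ?divr_gt0//.
    by rewrite truncnS_gt.
  have /choice[q qP] : forall i : 'I_n, exists q : rat,
      ratr q \in `]((f x : 'rV[R]_n) 0 i - k.+1%:R^-1),
                    ((f x : 'rV[R]_n) 0 i + k.+1%:R^-1)[.
    move=> i; apply: rat_in_itvoo; rewrite ltrD2l.
    by rewrite gtrN// invr_gt0.
  exists (\row_i q i, k) => /=.
    move=> y /= yq; apply: xeU; split => // i j; rewrite ord1 /ball/=.
    move: (yq j) (qP j); rewrite !mxE !in_itv/= => /andP[a b] /andP[c g].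
    exact: (close_aux ke a b c g).
  move=> i _ /=; move: (qP i); rewrite !mxE !in_itv/= => /andP[c g].
  by rewrite ltrBlDr g -ltrBlDr c.
rewrite bigcup_mkcond; apply: countable_bigcupT_measurable => [|qk].
  exact: countableP.
case: ifPn => // _; apply: fin_bigcap_measurable => // i _.
by rewrite -[X in measurable X]setTI; exact: mf.
Qed.

Lemma rV_coord_measurable (R : realType) n (i : 'I_n) :
  measurable_fun setT (fun x : borel 'rV[R]_n => (x : 'rV[R]_n) 0 i).
Proof.
apply: (measurability _ (RGenOpens.measurableE R)) => _ [_ [a [b ->] <-]].
rewrite setTI; apply: sub_sigma_algebra.
apply: open_comp; first by move=> x _; exact: coord_continuous.
exact: interval_open.
Qed.

Definition rV_cons (R : realType) n (tx : measurableTypeR R * borel 'rV[R]_n) :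
  borel 'rV[R]_n.+1 :=
  \row_i (if unlift ord0 i is Some j then (tx.2 : 'rV[R]_n) 0 j else tx.1).

Lemma measurable_rV_cons (R : realType) n : measurable_fun setT (@rV_cons R n).
Proof.
apply: rV_borelP => i; under eq_fun do rewrite mxE.
case: unliftP => [j _|_]; last exact: measurable_fst.
apply: (measurableT_comp (@rV_coord_measurable R n j)); exact: measurable_snd.
Qed.

Definition rV_uncons (R : realType) n (x : borel 'rV[R]_n.+1) :
  measurableTypeR R * borel 'rV[R]_n :=
  ((x : 'rV[R]_n.+1) 0 ord0, \row_j (x : 'rV[R]_n.+1) 0 (lift ord0 j)).

Lemma measurable_rV_uncons (R : realType) n :
  measurable_fun setT (@rV_uncons R n).
Proof.
apply/measurable_fun_pairP; split; first exact: rV_coord_measurable.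
by apply: rV_borelP => i /=; under eq_fun do rewrite mxE;
   exact: rV_coord_measurable.
Qed.

Lemma rV_consK (R : realType) n : cancel (@rV_cons R n) (@rV_uncons R n).
Proof.
move=> [t x]; rewrite /rV_uncons /rV_cons /=; congr pair.
  by rewrite mxE unlift_none.
by apply/rowP => j; rewrite !mxE liftK.
Qed.


HB.instance Definition _ (R : realType) n :=
  isMeasurableFun.Build _ _ _ _ (@rV_cons R n) (@measurable_rV_cons R n).

Section image_measure.
Context d1 d2 (T1 : measurableType d1) (T2 : measurableType d2) (R : realType).
Variables (mu : {measure set T1 -> \bar R}) (f : {mfun T1 >-> T2}).

Definition image_measure : set T2 -> \bar R := pushforward mu f.

Let image_measure0 : image_measure set0 = 0%E. Proof. exact: measure0. Qed.

Let image_measure_ge0 A : (0 <= image_measure A)%E.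
Proof. exact: measure_ge0. Qed.

Let image_measure_sigma_additive : semi_sigma_additive image_measure.
Proof. exact: measure_semi_sigma_additive. Qed.

HB.instance Definition _ := isMeasure.Build _ _ _ image_measure
  image_measure0 image_measure_ge0 image_measure_sigma_additive.

End image_measure.

Lemma product_sigma_finite d1 d2 (T1 : measurableType d1)
    (T2 : measurableType d2) (R : realType)
    (m1 : {sigma_finite_measure set T1 -> \bar R})
    (m2 : {sigma_finite_measure set T2 -> \bar R}) :
  sigma_finite setT (m1 \x m2)%E.
Proof.
have /sigma_finiteP[F [TF ndF Foo]] := sigma_finiteT m1.
have /sigma_finiteP[G [TG ndG Goo]] := sigma_finiteT m2.
exists (fun n => F n `*` G n) => [|k].
  rewrite -setXTT TF TG; apply/seteqP; split => -[x y] /=; last first.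
    by move=> [n _ []/= ? ?]; split; exists n.
  move=> [/= [n _ Fnx] [k _ Gky]]; exists (maxn n k) => //; split.
    by move: x Fnx; exact/subsetPset/ndF/leq_maxl.
  by move: y Gky; exact/subsetPset/ndG/leq_maxr.
have [? ?] := Foo k; have [? ?] := Goo k; split; first exact: measurableX.
by rewrite product_measure1E// lte_mul_pinfty// ge0_fin_numE.
Qed.

Section lebesgue_rV_succ.
Variables (R : realType) (n : nat).
Variable mu : {sigma_finite_measure set (borel 'rV[R]_n) -> \bar R}.

Definition lebesgue_rVS : set (borel 'rV[R]_n.+1) -> \bar R :=
  image_measure (@lebesgue_measure R \x mu)%E (@rV_cons R n).

HB.instance Definition _ := Measure.on lebesgue_rVS.

Let lebesgue_rVS_sigma_finite : sigma_finite setT lebesgue_rVS.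
Proof.
have [F FT mF] := product_sigma_finite (@lebesgue_measure R) mu.
exists (fun k => @rV_uncons R n @^-1` F k).
  by rewrite -preimage_bigcup -FT preimage_setT.
move=> k; have [mFk Fkoo] := mF k; split.
  by rewrite -[X in measurable X]setTI; exact: measurable_rV_uncons.
rewrite /lebesgue_rVS /image_measure /pushforward -comp_preimage.
rewrite (_ : _ \o _ = id) ?preimage_id//.
by apply/funext => x /=; rewrite rV_consK.
Qed.

HB.instance Definition _ :=
  Measure_isSigmaFinite.Build _ _ _ lebesgue_rVS lebesgue_rVS_sigma_finite.

End lebesgue_rV_succ.

Fixpoint lebesgue_rV (R : realType) n :
    {sigma_finite_measure set (borel 'rV[R]_n) -> \bar R} :=
  if n is m.+1 then lebesgue_rVS (lebesgue_rV R m) else \d_(0 : borel 'rV[R]_0).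

Definition enorm (R : realType) n (x : 'rV[R]_n) : R :=
  Num.sqrt (\sum_i x 0 i ^+ 2).

Definition eball (R : realType) n (r : R) : set (borel 'rV[R]_n) :=
  [set x | enorm x < r].

(* (enorm 0)^-1 = 0, so direction 0 = 0. *)
Definition direction (R : realType) n (x : borel 'rV[R]_n) : borel 'rV[R]_n :=
  (enorm x)^-1 *: (x : 'rV[R]_n).

Lemma measurable_enorm (R : realType) n :
  measurable_fun setT (@enorm R n : borel 'rV[R]_n -> R).
Proof.
rewrite (_ : @enorm R n =
    fun x => powR (\sum_i (x : 'rV[R]_n) 0 i ^+ 2) 2^-1); last first.
  by apply/funext => x; rewrite powR12_sqrt// sumr_ge0// => i _; exact: sqr_ge0.
apply: (measurableT_comp (measurable_powR _)).
apply: measurable_sum => i; apply: measurable_funX.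
exact: rV_coord_measurable.
Qed.

Lemma measurable_eball (R : realType) n (r : R) : measurable (@eball R n r).
Proof.
rewrite (_ : eball r = setT `&` (@enorm R n @^-1` `]-oo, r[)).
  exact: measurable_enorm.
by rewrite setTI; apply/seteqP; split => x; rewrite /eball /= in_itv.
Qed.

Lemma measurable_direction (R : realType) n :
  measurable_fun setT (@direction R n).
Proof.
apply: rV_borelP => i; rewrite /direction.
under eq_fun => x do rewrite mxE -powR_inv1 ?sqrtr_ge0//.
apply: measurable_funM; last exact: rV_coord_measurable.
by apply: (measurableT_comp (measurable_powR _)); exact: measurable_enorm.
Qed.

HB.instance Definition _ (R : realType) n :=
  isMeasurableFun.Build _ _ _ _ (@direction R n) (@measurable_direction R n).

(* Surface measure of the unit sphere, sigma(A) = n * |{r u : 0 < r < 1, u \in A}|,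
   as a measure on R^n carried by the sphere; for n = 1 it is counting measure
   on {-1, 1}. *)
Definition sphere_measure (R : realType) n :
    {measure set (borel 'rV[R]_n) -> \bar R} :=
  mscale n%:R%:nng
    (image_measure (mrestr (lebesgue_rV R n) (@measurable_eball R n 1))
       (@direction R n)).

(* C^k on an open set U: the directional derivatives x |-> 'd g x v are C^(k-1)
   for every v, which in finite dimension is C^(k-1) for the differential. *)
Fixpoint Ck (R : realType) (V W : normedModType R) (k : nat) (U : set V)
    (g : V -> W) : Prop :=
  if k is k'.+1
  then (forall x, U x -> differentiable g x) /\
       (forall v, Ck k' U (fun x => 'd g x v : W))
  else forall x, U x -> {for x, continuous g}.

Definition bform (R : realType) n (G : 'M[R]_n) (v w : 'rV[R]_n) : R :=
  (v *m G *m w^T) 0 0.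

(* A chart i consists of mutually inverse maps coord i and param i between the
   open sets dom i and coord i @` dom i; their values elsewhere are junk. The
   metric is C^1, the regularity that is invariant under C^2 changes of chart. *)
Record riemannian (R : realType) (n : nat) := Riemannian {
  points :> ptopologicalType;
  points_hausdorff : hausdorff_space points;
  points_second_countable : @second_countable points;
  chart : Type;
  dom : chart -> set points;
  coord : chart -> points -> 'rV[R]_n;
  param : chart -> 'rV[R]_n -> points;
  chart_at : points -> chart;
  dom_chart_at : forall x, dom (chart_at x) x;
  open_dom : forall i, open (dom i);
  open_coord : forall i, open (coord i @` dom i);
  coordK : forall i x, dom i x -> param i (coord i x) = x;
  continuous_coord : forall i x, dom i x -> {for x, continuous (coord i)};
  continuous_param : forall i u, (coord i @` dom i) u ->
    {for u, continuous (param i)};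
  transition_C2 : forall i j,
    Ck 2 (coord i @` (dom i `&` dom j)) (coord j \o param i);
  metric : chart -> 'rV[R]_n -> 'M[R]_n;
  metric_C1 : forall i, Ck 1 (coord i @` dom i) (metric i);
  metric_sym : forall i u, (coord i @` dom i) u -> (metric i u)^T = metric i u;
  metric_pos : forall i u, (coord i @` dom i) u ->
    forall v, v != 0 -> 0 < bform (metric i u) v v;
  metric_transition : forall i j u, (coord i @` (dom i `&` dom j)) u ->
    forall v w, bform (metric i u) v w =
      bform (metric j ((coord j \o param i) u))
        ('d (coord j \o param i) u v) ('d (coord j \o param i) u w)
}.

Section riemannian_notions.
Context (R : realType) (n : nat) (N : riemannian R n).

Definition C1_curve (c : R -> N) : Prop :=
  continuous c /\
  forall i, Ck 1 (c @^-1` dom i : set R^o) (coord i \o c : R^o -> 'rV[R]_n).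

Definition speed (c : R -> N) (t : R) : R :=
  let i := chart_at (c t) in
  let v := 'd (coord i \o c : R^o -> 'rV[R]_n) (t : R^o) (1 : R^o) in
  Num.sqrt (bform (metric i (coord i (c t))) v v).

Definition curve_length (c : R -> N) : \bar R :=
  (\int[lebesgue_measure]_(t in `[0%R, 1%R]) (speed c t)%:E)%E.

(* Piecewise C^1 curves on [0, 1] give the same infimum: reparametrise each piece
   so that it starts and ends with zero speed, and extend by constants to R. *)
Definition rdist (x y : N) : \bar R :=
  ereal_inf [set curve_length c | c in
    [set c | [/\ C1_curve c, c 0 = x & c 1 = y]]].

Definition tube (e : R) (A : set N) : set (borel N) :=
  [set x | (ereal_inf [set rdist x y | y in A] < e%:E)%E].

(* A C^2 immersion of V, an open subset of R^j, which is a homeomorphism onto a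
   relatively open subset of S. *)
Definition local_param j (S : set N) (V : set 'rV[R]_j)
    (g : 'rV[R]_j -> N) : Prop :=
  [/\ open V /\ set_inj V g,
      forall v, V v -> {for v, continuous g},
      forall V', open V' -> V' `<=` V ->
        exists2 O : set N, open O & g @` V' = S `&` O,
      forall i, Ck 2 (V `&` g @^-1` dom i) (coord i \o g) &
      forall i v, V v -> dom i (g v) -> injective ('d (coord i \o g) v)].

Definition embedded_submanifold j (S : set N) : Prop :=
  forall x, S x -> exists V g, local_param (j := j) S V g /\ (g @` V) x.

Definition gram j (g : 'rV[R]_j -> N) (v : 'rV[R]_j) : 'M[R]_j :=
  let i := chart_at (g v) in
  \matrix_(a, b) bform (metric i (coord i (g v)))
    ('d (coord i \o g) v (delta_mx 0 a)) ('d (coord i \o g) v (delta_mx 0 b)).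

(* The j-dimensional Riemannian volume of the submanifold S, viewed as a Borel
   measure on N carried by S; the volume of N is the case S = N, j = n. *)
Definition riemannian_volume j (S : set N)
    (mu : {measure set (borel N) -> \bar R}) : Prop :=
  mu (~` S) = 0%E /\
  forall V g, local_param (j := j) S V g ->
  forall A : set (borel N), measurable A -> A `<=` g @` V ->
    mu A = (\int[lebesgue_rV R j]_(v in V `&` g @^-1` A)
              (Num.sqrt (\det (gram g v)))%:E)%E.

(* In nmap_C1, smoothness in the base point is read through the parametrizations
   of the stratum and the charts of N. *)
Record normal_cells (vol : {measure set (borel N) -> \bar R}) (l : nat)
    (Sigma : 'I_l.+1 -> set N)
    (volS : 'I_l.+1 -> {measure set (borel N) -> \bar R}) (M : set N) :=
  NormalCells {
  cell_radius : R;
  cell_radius_gt0 : 0 < cell_radius;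
  piece : finType;
  stratum : piece -> 'I_l.+1;
  codim := fun k => (n - stratum k)%N;
  base : piece -> set (borel N);
  base_measurable : forall k, measurable (base k);
  base_stratum : forall k, base k `<=` Sigma (stratum k);
  base_finite : forall k, (volS (stratum k) (base k) < +oo)%E;
  base_cover : \bigcup_k base k = M;
  base_disjoint : trivIset setT base;
  base_nbhd : piece -> set N;
  base_nbhd_open : forall k, exists2 O : set N,
    open O & base_nbhd k = Sigma (stratum k) `&` O;
  base_nbhd_sub : forall k, base k `<=` base_nbhd k;
  nmap : forall k, N -> 'rV[R]_(codim k) -> N;
  nmap0 : forall k p, base_nbhd k p -> @nmap k p 0 = p;
  nmap_C1 : forall k V g,
    local_param (j := stratum k) (Sigma (stratum k)) V g ->
    let D := [set vs : 'rV[R]_(stratum k) * 'rV[R]_(codim k) |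
      [/\ V vs.1, base_nbhd k (g vs.1) & enorm vs.2 < cell_radius]] in
    let h := fun vs : 'rV[R]_(stratum k) * 'rV[R]_(codim k) =>
      @nmap k (g vs.1) vs.2 in
    (forall vs, D vs -> {for vs, continuous h}) /\
    (forall i, Ck 1 (D `&` h @^-1` dom i) (coord i \o h));
  cell : forall k, N -> set (borel 'rV[R]_(codim k));
  cell_measurable : forall k,
    measurable [set ps : borel N * borel 'rV[R]_(codim k) |
      base k ps.1 /\ @cell k ps.1 ps.2];
  ndomain := fun k => [set ps : borel N * borel 'rV[R]_(codim k) |
    base k ps.1 /\ (@cell k ps.1 `&` eball cell_radius) ps.2];
  nimage := fun k : piece => ((fun ps => @nmap k ps.1 ps.2) @` @ndomain k
    : set (borel N));
  nimage_disjoint : forall k k', k != k' ->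
    vol.-negligible (@nimage k `&` @nimage k');
  nimage_cover : vol.-negligible (tube cell_radius M `\` \bigcup_k @nimage k);
  jac : forall k, N -> 'rV[R]_(codim k) -> R;
  jac_gt0 : forall k p s, @ndomain k (p, s) -> 0 < @jac k p s;
  jac_measurable : forall k,
    measurable_fun (@ndomain k) (fun ps => @jac k ps.1 ps.2);
  change_of_variables : forall k (h : borel N -> \bar R),
    measurable_fun setT h -> (forall x, 0 <= h x)%E ->
    (\int[vol]_(x in @nimage k) h x =
     \int[volS (stratum k)]_(p in base k)
       \int[lebesgue_rV R (codim k)]_(s in @cell k p `&` eball cell_radius)
         (h (@nmap k p s) * (@jac k p s)%:E))%E
}.

End riemannian_notions.


Arguments codim {R n N vol l Sigma volS M C} k : rename.
Arguments base {R n N vol l Sigma volS M C} k p : rename.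
Arguments nmap {R n N vol l Sigma volS M C} k p s : rename.
Arguments cell {R n N vol l Sigma volS M C} k p s : rename.
Arguments jac {R n N vol l Sigma volS M C} k p s : rename.

Section integrals.
Context (R : realType).

Definition cintegral d (T : measurableType d) (mu : {measure set T -> \bar R})
    (D : set T) (g : T -> R[i]) : R[i] :=
  Complex (\int[mu]_(x in D) complex.Re (g x))
          (\int[mu]_(x in D) complex.Im (g x)).

Definition cintegrable d (T : measurableType d)
    (mu : {measure set T -> \bar R}) (D : set T) (g : T -> R[i]) : Prop :=
  mu.-integrable D (fun x => (complex.Re (g x))%:E) /\
  mu.-integrable D (fun x => (complex.Im (g x))%:E).

Definition cmeasurable d (T : measurableType d) (g : T -> R[i]) : Prop :=
  measurable_fun setT (fun x => complex.Re (g x)) /\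
  measurable_fun setT (fun x => complex.Im (g x)).

Definition gamma (x : R) : R :=
  \int[lebesgue_measure]_(t in `]0, +oo[) (t `^ (x - 1) * expR (- t)).

(* The supremum over G of a nonnegative function; adding 0 only matters for an
   empty G, where it gives 0 instead of -oo. *)
Definition usup T (G : set T) (h : T -> R) : \bar R :=
  ereal_sup ([set 0%E] `|` [set (h x)%:E | x in G]).

End integrals.

Section radial.
Context (R : realType) (n : nat) (N : riemannian R n).
Context (vol : {measure set (borel N) -> \bar R}) (l : nat).
Context (Sigma : 'I_l.+1 -> set N).
Context (volS : 'I_l.+1 -> {measure set (borel N) -> \bar R}) (M : set N).
Variables (C : normal_cells vol Sigma volS M) (k : piece C).
Variables (f : N -> R) (a : N -> R[i]).

Definition is_cone m (A : set 'rV[R]_m) : Prop :=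
  forall s t, A s -> 0 < t -> A (t *: s).

Definition directions (p : N) : set (borel 'rV[R]_(codim k)) :=
  [set s | cell k p s /\ enorm s = 1].

Definition direction_graph : set (borel N * borel 'rV[R]_(codim k)) :=
  [set ps | base k ps.1 /\ directions ps.1 ps.2].

Definition laplace (z : R) (p : N) : R[i] :=
  cintegral (lebesgue_rV R (codim k)) (cell k p `&` eball (cell_radius C))
    (fun s => a (nmap k p s) *
              (jac k p s * expR (- (z * f (nmap k p s))))%:C%C).

Definition laplace_radial (z : R) (p : N) (theta : 'rV[R]_(codim k)) : R[i] :=
  cintegral lebesgue_measure `]0, cell_radius C[
    (fun r => a (nmap k p (r *: theta)) *
              (jac k p (r *: theta) * expR (- (z * f (nmap k p (r *: theta))))
               * r ^+ (codim k).-1)%:C%C).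

End radial.

Arguments directions {R n N vol l Sigma volS M C} k p : rename.
Arguments direction_graph {R n N vol l Sigma volS M C} k : rename.
Arguments laplace {R n N vol l Sigma volS M C} k f a z p : rename.
Arguments laplace_radial {R n N vol l Sigma volS M C} k f a z p theta : rename.

(* Main.v *)
(* Laplace's method along rays, with every error bound uniform in the ray. For
   fixed (p, theta) put X = z c r^alpha. Where r is small the integrand differs
   from the model a(p) e^{-X} by at most eta times a constant multiple of
   e^{-kappa X}, and elsewhere (including beyond the cell radius, where the
   integrand is replaced by 0) both are O(e^{-2 kappa X}), which gains a factor
   exponentially small in z. Integrating the common majorant e^{-kappa X} r^{d-1}
   over the half line gives z^{-d/alpha} times a Gamma factor, by the substitution
   t = kappa X, and this factor is bounded over the compact range of alpha because
   Gamma on an interval is at most the sum of its values at the endpoints.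
   The remainder delta_z is the renormalised radial integral minus its limit, so
   the second claim reduces to measurability and boundedness in theta. *)
Require Import Defs.
From HB Require Import structures.
From mathcomp Require Import all_boot all_order all_algebra.
From mathcomp Require Import complex ring lra.
From mathcomp Require Import all_classical all_reals all_analysis measurable_realfun.
Set Implicit Arguments. Unset Strict Implicit. Unset Printing Implicit Defensive.
Import Order.TTheory GRing.Theory Num.Theory numFieldNormedType.Exports.
Local Open Scope classical_set_scope. Local Open Scope ring_scope. Local Open Scope complex_scope.

(** * Substitution on the half line and the Gamma integral *)

Section half_line.
Context {R : realType}.
Local Notation mu := (@lebesgue_measure R).

Lemma continuous_gt0_measurable (G : R -> R) :
  (forall t : R, 0 < t -> {for t, continuous G}) -> measurable_fun (`]0, +oo[ : set R) G.
Proof.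
move=> cG; apply: open_continuous_measurable_fun; first exact: interval_open.
by move=> t; rewrite inE/= in_itv/= andbT => /cG.
Qed.

Let exhaust (n : nat) : set R := `[n.+1%:R^-1, n.+1%:R].

Let exhaust_gt0 n : 0 < n.+1%:R^-1 :> R. Proof. by rewrite invr_gt0. Qed.

Let exhaust_le n : n.+1%:R^-1 <= n.+1%:R :> R.
Proof. by rewrite (@le_trans _ _ 1)// ?invf_le1// ler1n. Qed.

Let exhaustP (r : R) : 0 < r -> exists n, n.+1%:R^-1 <= r <= n.+1%:R.
Proof.
move=> r0; exists (Num.truncn (r + r^-1)).
have h : r + r^-1 < (Num.truncn (r + r^-1)).+1%:R by rewrite truncnS_gt.
have ri : 0 < r^-1 by rewrite invr_gt0.
rewrite invf_ple ?posrE//; apply/andP; split; apply: ltW; apply: le_lt_trans h.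
  by rewrite lerDr ltW.
by rewrite lerDl ltW.
Qed.

(** On each compact [exhaust n] this is the substitution formula for increasing functions, and
    monotone convergence carries both sides to the half line. The hypotheses stay on the open half
    line because the derivative of b r^a is unbounded at 0 when a < 1. *)
Lemma increasing_ge0_integration_by_substitution_gt0 (F F' G : R -> R) :
  (forall r : R, 0 < r -> is_derive r 1 F (F' r)) ->
  (forall r : R, 0 < r -> {for r, continuous F'}) ->
  (forall r s : R, 0 < r -> r < s -> F r < F s) ->
  (forall r : R, 0 < r -> 0 < F r) ->
  (forall t : R, 0 < t -> exists2 r : R, 0 < r & F r = t) ->
  (forall t : R, 0 < t -> {for t, continuous G}) ->
  (forall t : R, 0 < t -> 0 <= G t) ->
  (\int[mu]_(t in `]0%R, +oo[) (G t)%:E =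
   \int[mu]_(r in `]0%R, +oo[) (G (F r) * F' r)%:E)%E.
Proof.
move=> dF cF' incF F0 surjF cG G0.
have cF (r : R) : 0 < r -> {for r, continuous F}.
  by move=> r0; apply/differentiable_continuous/derivable1_diffP; have [] := dF _ r0.
have F'E (r : R) : 0 < r -> derive1 F r = F' r.
  by move=> r0; rewrite derive1E; have [_ ->] := dF _ r0.
have gt0_near (r : R) : 0 < r -> \forall x \near nbhs r, 0 < x.
  exact: lt_nbhsr.
have leF (r s : R) : 0 < r -> r <= s -> F r <= F s.
  by move=> r0; rewrite le_eqVlt => /predU1P[->//|/(incF _ _ r0)/ltW].
have F'0 (r : R) : 0 < r -> 0 <= F' r.
  move=> r0; rewrite -F'E//.
  apply: (@incr_derive1_ge0 R F `]0, +oo[%classic) => [x|x y|].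
  - by rewrite interior_itv inE/= in_itv/= andbT => x0; have [] := dF _ x0.
  - by rewrite !inE/= !in_itv/= !andbT => x0 y0; exact: incF.
  - by rewrite interior_itv /= in_itv/= r0.
have cdF (r : R) : 0 < r -> {for r, continuous (derive1 F)}.
  move=> r0; rewrite /prop_for /continuous_at F'E//.
  have e : {near nbhs r, F' =1 derive1 F}.
    by near=> x; rewrite F'E//; near: x; exact: gt0_near.
  exact: cvg_trans (near_eq_cvg e) (cF' _ r0).
have cGF (r : R) : 0 < r -> {for r, continuous (fun x => G (F x) * F' x)}.
  move=> r0; apply: cvgM; last exact: cF'.
  by apply: continuous_comp; [exact: cF|apply: cG; exact: F0].
(* The image of [exhaust n] under [F]. These intervals are nested since [F] increases, and they fill
   the half line since [F] is onto it. *)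
pose imF (n : nat) : set R := `[F n.+1%:R^-1, F n.+1%:R]%classic.
have Hl : (\int[mu]_(t in imF n) (G t)%:E)%E @[n --> \oo]
    --> (\int[mu]_(t in `]0%R, +oo[) (G t)%:E)%E.
  have -> : `]0, +oo[%classic = \bigcup_n imF n.
    apply/seteqP; split=> [t|t [n _]]; rewrite /= !in_itv/= ?andbT.
      move=> /surjF[r r0 <-]; have [n /andP[nr rn]] := exhaustP r0.
      exists n => //; rewrite /imF /= in_itv/=; apply/andP; split; apply: leF => //.
    by rewrite /imF /= in_itv/= => /andP[+ _]; apply: lt_le_trans; exact: F0.
  apply: ge0_nondecreasing_set_cvg_integral => //.
  - move=> m n mn; apply/subsetPset => t; rewrite /imF /exhaust /= !in_itv/= => /andP[a b].
    apply/andP; split.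
      by apply: le_trans a; apply: leF => //; rewrite lef_pV2 ?posrE// ler_nat.
    by apply: le_trans b _; apply: leF => //; rewrite ler_nat.
  - by move=> n; exact: measurable_itv.
  - move=> n; apply/measurable_EFinP.
    apply: measurable_funS (continuous_gt0_measurable cG) => // t; rewrite /imF /exhaust /=.
    rewrite !in_itv/= andbT => /andP[+ _]; apply: lt_le_trans; exact: F0.
  - move=> n t; rewrite /imF /exhaust /= in_itv/= lee_fin => /andP[h _]; apply: G0.
    apply: lt_le_trans h; exact: F0.
have Hr : (\int[mu]_(r in exhaust n) (G (F r) * F' r)%:E)%E @[n --> \oo]
    --> (\int[mu]_(r in `]0%R, +oo[) (G (F r) * F' r)%:E)%E.
  have -> : `]0, +oo[%classic = \bigcup_n exhaust n.
    apply/seteqP; split=> [r|r [n _]]; rewrite /= !in_itv/= ?andbT.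
      move=> r0; have [n /andP[nr rn]] := exhaustP r0.
      by exists n => //; rewrite /exhaust /= in_itv/= nr.
    by rewrite /exhaust /= in_itv/= => /andP[+ _]; apply: lt_le_trans.
  apply: ge0_nondecreasing_set_cvg_integral => //.
  - move=> m n mn; apply/subsetPset => t; rewrite /imF /exhaust /= !in_itv/= => /andP[a b].
    apply/andP; split.
      by apply: le_trans a; rewrite lef_pV2 ?posrE// ler_nat.
    by apply: le_trans b _; rewrite ler_nat.
  - by move=> n; exact: measurable_itv.
  - move=> n; apply/measurable_EFinP.
    apply: measurable_funS (continuous_gt0_measurable cGF) => // t; rewrite /imF /exhaust /=.
    by rewrite !in_itv/= andbT => /andP[+ _]; apply: lt_le_trans.
  - move=> n t; rewrite /imF /exhaust /= in_itv/= lee_fin => /andP[h _].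
    have t0 : 0 < t by apply: lt_le_trans h.
    by apply: mulr_ge0; [apply/G0/F0|exact: F'0].
(* The two sequences agree term by term, so their limits do. *)
apply: (cvg_unique _ Hl); first exact: ereal_hausdorff.
rewrite [X in X @ _](_ : _ = fun n => (\int[mu]_(r in exhaust n) (G (F r) * F' r)%:E)%E)//.
apply/funext => n.
have p0 (x : R) : x \in `[n.+1%:R^-1, n.+1%:R]%R -> 0 < x :> R.
  by rewrite in_itv/= => /andP[+ _]; apply: lt_le_trans.
have p0o (x : R) : x \in `]n.+1%:R^-1, n.+1%:R[%R -> 0 < x :> R.
  by rewrite in_itv/= => /andP[+ _]; apply: lt_trans.
rewrite integration_by_substitution_increasing//.
- apply: eq_integral => x; rewrite inE => /p0 x0.
  by rewrite [in LHS]/GRing.mul/= F'E.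
- by move=> x y /p0 x0 _; exact: incF.
- by move=> x /p0o/cdF.
- apply/cvg_ex; eexists; apply: cvg_at_right_filter; exact: cdF.
- apply/cvg_ex; eexists; apply: cvg_at_left_filter; exact: cdF.
- split.
  + by move=> x /p0o x0; have [] := dF _ x0.
  + by apply: cvg_at_right_filter; exact: cF.
  + by apply: cvg_at_left_filter; exact: cF.
- apply: continuous_in_subspaceT => x; rewrite inE/= in_itv/= => /andP[h _].
  by apply: cG; apply: lt_le_trans h; exact: F0.
Unshelve. all: by end_near. Qed.

End half_line.

(** * The Gamma integral: finiteness, control in the parameter, radial form *)

Section gamma_function.
Context {R : realType}.
Local Notation mu := (@lebesgue_measure R).
Implicit Types a b x r t : R.

(** This is ln v <= v - 1 at v = u / y, multiplied by y and exponentiated; the spare factor e^(-y)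
    is dropped. *)
Lemma powR_le_expR (y u : R) : 0 < y -> 0 < u -> u `^ y <= y `^ y * expR u.
Proof.
move=> y0 u0; have uy0 : 0 < u / y by rewrite divr_gt0.
rewrite -[in leLHS](divfK (lt0r_neq0 y0) u) mulrC powRM ?(ltW y0) ?(ltW uy0)//.
rewrite ler_wpM2l ?powR_ge0// /powR gt_eqF// ler_expR.
have := @le_ln1Dx R (u / y - 1); rewrite addrCA subrr addr0 => /(_ _)/= h.
have {h} : ln (u / y) <= u / y - 1 by apply: h; lra.
move=> /(ler_wpM2l (ltW y0)) /le_trans; apply.
by rewrite mulrBr mulrCA divff ?lt0r_neq0// !mulr1 lerBlDr lerDl ltW.
Qed.

Lemma continuous_powR a r : 0 < r -> {for r, continuous (fun s : R => s `^ a)}.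
Proof.
by move=> r0; apply/differentiable_continuous/derivable1_diffP; have [] := is_derive1_powR a r0.
Qed.

Lemma power_substitution (G : R -> R) a b : 0 < a -> 0 < b ->
  (forall t : R, 0 < t -> {for t, continuous G}) ->
  (forall t : R, 0 < t -> 0 <= G t) ->
  (\int[mu]_(t in `]0%R, +oo[) (G t)%:E =
   \int[mu]_(r in `]0%R, +oo[) (G (b * r `^ a) * (b * (a * r `^ (a - 1))))%:E)%E.
Proof.
move=> a0 b0 cG G0.
apply: (increasing_ge0_integration_by_substitution_gt0
  (F := fun r => b * r `^ a) (F' := fun r => b * (a * r `^ (a - 1)))) => //.
- move=> r r0; have h := is_derive1_powR a r0.
  have := is_deriveM (is_derive_cst (b : R) r (1 : R)) h.
  by rewrite scaler0 addr0.
- move=> r r0; apply: cvgM; first exact: cvg_cst.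
  by apply: cvgM; [exact: cvg_cst|exact: continuous_powR].
- move=> r s r0 rs; rewrite ltr_pM2l//.
  by apply: gt0_ltr_powR => //; rewrite nnegrE ltW// (lt_trans r0).
- by move=> r r0; rewrite mulr_gt0// powR_gt0.
- move=> t t0; exists ((t / b) `^ a^-1); first by rewrite powR_gt0// divr_gt0.
  rewrite -powRrM mulVf ?gt_eqF// powRr1 ?divr_ge0 ?ltW//.
  by rewrite mulrCA divff ?mulr1 ?gt_eqF.
Qed.

(** Two cases matter: a = 1 / x, where the power of r disappears, and a x = d, where the radial
    weight r^(d-1) remains. *)
Lemma power_substitution_jacobian a b x r : 0 < b -> 0 < r ->
  (b * r `^ a) `^ (x - 1) * (b * (a * r `^ (a - 1))) =
  a * b `^ x * r `^ (a * x - 1).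
Proof.
move=> b0 r0; rewrite powRM ?powR_ge0 ?(ltW b0)// -powRrM.
have -> : a * x - 1 = a * (x - 1) + (a - 1) by ring.
have -> : b `^ x = b `^ (x - 1) * b.
  by rewrite -[X in _ * X](powRr1 (ltW b0)) -powRD ?subrK// (gt_eqF b0) implybT.
rewrite [r `^ (a * (x - 1) + _)]powRD ?(gt_eqF r0) ?implybT//; ring.
Qed.

Lemma measurable_gamma_integrand x :
  measurable_fun (`]0, +oo[ : set R) (fun t => t `^ (x - 1) * expR (- t)).
Proof.
apply: measurable_funTS; apply: measurable_funM; first exact: measurable_powR.
by apply: measurableT_comp => //; exact: measurable_funN.
Qed.

Lemma continuous_gamma_integrand x t : 0 < t ->
  {for t, continuous (fun t => t `^ (x - 1) * expR (- t))}.
Proof.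
move=> t0; apply: cvgM; first exact: continuous_powR.
by apply: continuous_comp; [exact: continuousN|exact: continuous_expR].
Qed.

(** The substitution t = s^(1/x) removes the singularity at 0 and leaves e^(-s^(1/x)) / x, which is
    dominated by a multiple of 1 / (1 + s^2). *)
Lemma integral_gamma_lty x : 0 < x ->
  (\int[mu]_(t in `]0%R, +oo[) (t `^ (x - 1) * expR (- t))%:E < +oo)%E.
Proof.
move=> x0; have xV0 : 0 < x^-1 by rewrite invr_gt0.
rewrite (@power_substitution _ x^-1 1)//; last 2 first.
- by move=> t; exact: continuous_gamma_integrand.
- by move=> t _; rewrite mulr_ge0 ?powR_ge0 ?expR_ge0.
(* With u = s^(1/x) one has s^2 = u^y, so [powR_le_expR] together with 1 <= e^u gives 1 + s^2 <= (1
   + y^y) e^u. This is the origin of [K]. *)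
pose y := 2 * x; have y0 : 0 < y by rewrite mulr_gt0.
pose K := x^-1 * (1 + y `^ y).
have K0 : 0 <= K by rewrite mulr_ge0 ?(ltW xV0)// addr_ge0 ?powR_ge0.
apply: (@le_lt_trans _ _ (\int[mu]_(s in `]0%R, +oo[) (K * (oneDsqr s)^-1)%:E)%E).
  apply: ge0_le_integral => //.
  - move=> r; rewrite /= in_itv/= andbT => r0; rewrite lee_fin.
    by rewrite !mulr_ge0 ?powR_ge0 ?expR_ge0 ?(ltW xV0).
  - apply/measurable_EFinP; apply: continuous_gt0_measurable => r r0.
    apply: cvgM.
      apply: (@continuous_comp _ _ _ (fun r : R => 1 * r `^ x^-1) (fun t => t `^ (x - 1) * expR (- t))).
        by apply: cvgM; [exact: cvg_cst|exact: continuous_powR].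
      by apply: continuous_gamma_integrand; rewrite mul1r powR_gt0.
    apply: cvgM; first exact: cvg_cst.
    by apply: cvgM; [exact: cvg_cst|exact: continuous_powR].
  - apply/measurable_EFinP; apply: continuous_gt0_measurable => r r0.
    by apply: cvgM; [exact: cvg_cst|exact: continuous_oneDsqrV].
  - move=> r; rewrite /= in_itv/= andbT => r0; rewrite lee_fin.
    rewrite mulrAC power_substitution_jacobian// powR1 mulVf ?gt_eqF// subrr powRr0 !mulr1 mul1r.
    rewrite /K -mulrA ler_pM2l// expRN ler_pdivlMr ?(lt_le_trans ltr01) ?oneDsqr_ge1//.
    rewrite mulrC ler_pdivrMr ?expR_gt0// mulrDl mul1r /oneDsqr lerD//.
      by rewrite -expR0 ler_expR powR_ge0.
    have -> : r ^+ 2 = (r `^ x^-1) `^ y.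
      by rewrite -powRrM /y mulrCA mulVf ?gt_eqF// mulr1 -powR_mulrn// ltW.
    by apply: powR_le_expR => //; rewrite powR_gt0.
under eq_integral do rewrite EFinM.
rewrite ge0_integralZl//; last first.
  apply/measurable_EFinP; apply: continuous_gt0_measurable => r r0.
  exact: continuous_oneDsqrV.
apply: lte_mul_pinfty => //.
apply: (@le_lt_trans _ _ (\int[mu]_(s in `[0%R, +oo[) (oneDsqr s)^-1%:E)%E); last first.
  by rewrite integral0y_oneDsqr ltry.
apply: ge0_subset_integral => //.
- apply/measurable_EFinP; apply: measurable_funTS; apply: continuous_measurable_fun.
  exact: continuous_oneDsqrV.
- by move=> r; rewrite /= !in_itv/= !andbT => /ltW.
Qed.

Lemma integrable_gamma x : 0 < x ->
  mu.-integrable `]0, +oo[ (fun t => (t `^ (x - 1) * expR (- t))%:E).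
Proof.
move=> x0; apply/integrableP; split.
  by apply/measurable_EFinP; exact: measurable_gamma_integrand.
under eq_integral do rewrite gee0_abs ?lee_fin ?mulr_ge0 ?powR_ge0 ?expR_ge0//.
exact: integral_gamma_lty.
Qed.

Lemma gammaE x : 0 < x ->
  (\int[mu]_(t in `]0%R, +oo[) (t `^ (x - 1) * expR (- t))%:E = (gamma x)%:E)%E.
Proof.
move=> x0; rewrite /gamma /Rintegral fineK// ge0_fin_numE ?integral_gamma_lty//.
by apply: integral_ge0 => t _; rewrite lee_fin mulr_ge0 ?powR_ge0 ?expR_ge0.
Qed.

Lemma gamma_ge0 x : 0 <= gamma x.
Proof. by apply: Rintegral_ge0 => t _; rewrite mulr_ge0 ?powR_ge0 ?expR_ge0. Qed.

(** The bound holds under the integral sign: t^(y-1) is at most t^(x-1) for t <= 1 and at most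
    t^(z-1) for t > 1. *)
Lemma gamma_le_endpoints (x y z : R) : 0 < x -> x <= y -> y <= z ->
  gamma y <= gamma x + gamma z.
Proof.
move=> x0 xy yz; have y0 := lt_le_trans x0 xy; have z0 := lt_le_trans y0 yz.
rewrite -RintegralD//; [|exact: integrable_gamma..].
apply: le_Rintegral => //; first exact: integrable_gamma.
  rewrite [X in integrable _ _ X](_ : _ =
    (fun t => (t `^ (x - 1) * expR (- t))%:E) \+ (fun t => (t `^ (z - 1) * expR (- t))%:E))%E //.
  by apply: integrableD => //; exact: integrable_gamma.
move=> t; rewrite /= in_itv/= andbT => t0.
rewrite -mulrDl ler_wpM2r ?expR_ge0//.
have [t1|t1] := leP t 1.
  apply: (@le_trans _ _ (t `^ (x - 1))); last by rewrite lerDl powR_ge0.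
  by apply: ger_powR; rewrite ?t0// lerD2r.
apply: (@le_trans _ _ (t `^ (z - 1))); last by rewrite lerDr powR_ge0.
by apply: ler_powR; rewrite ?(ltW t1)// lerD2r.
Qed.

(** The Gamma integral at d / a is transformed by t = b r^a. The extended-valued form also shows
    that the left side is finite. *)
Lemma integral_radial_model (d : nat) a b : (0 < d)%N -> 0 < a -> 0 < b ->
  (\int[mu]_(r in `]0%R, +oo[) (expR (- (b * r `^ a)) * r ^+ d.-1)%:E =
   (a^-1 * b `^ (- (d%:R / a)) * gamma (d%:R / a))%:E)%E.
Proof.
move=> d0 a0 b0; have x0 : 0 < d%:R / a by rewrite divr_gt0 ?ltr0n.
rewrite EFinM -gammaE// (@power_substitution (fun t => t `^ (d%:R / a - 1) * expR (- t)) a b)//; last 2 first.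
- by move=> t; exact: continuous_gamma_integrand.
- by move=> t _; rewrite mulr_ge0 ?powR_ge0 ?expR_ge0.
rewrite -ge0_integralZl//; last 3 first.
- apply/measurable_EFinP; apply: continuous_gt0_measurable => r r0.
  apply: cvgM.
    apply: (@continuous_comp _ _ _ (fun r : R => b * r `^ a) (fun t => t `^ (d%:R / a - 1) * expR (- t))).
      by apply: cvgM; [exact: cvg_cst|exact: continuous_powR].
    by apply: continuous_gamma_integrand; rewrite mulr_gt0 ?powR_gt0.
  apply: cvgM; first exact: cvg_cst.
  by apply: cvgM; [exact: cvg_cst|exact: continuous_powR].
- move=> r _; rewrite lee_fin.
  by rewrite !mulr_ge0 ?powR_ge0 ?expR_ge0 ?(ltW a0) ?(ltW b0).
- by rewrite lee_fin mulr_ge0 ?powR_ge0 ?invr_ge0 ?(ltW a0).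
apply: eq_integral => r; rewrite inE/= in_itv/= andbT => r0.
rewrite -EFinM; congr EFin.
rewrite (mulrAC (_ `^ (_ - 1))) power_substitution_jacobian// powRN.
have -> : a * (d%:R / a) - 1 = d.-1%:R.
  by rewrite mulrCA divff ?gt_eqF// mulr1 -[in LHS](prednK d0) -natr1 addrK.
rewrite powR_mulrn ?(ltW r0)//.
have bx : b `^ (d%:R / a) != 0 by rewrite gt_eqF// powR_gt0.
field; apply/andP; split => //; exact: lt0r_neq0.
Qed.

End gamma_function.

(** * The Laplace estimate along one ray *)

Section radial_estimate.
Context {R : realType}.
Local Notation mu := (@lebesgue_measure R).

(** For x <= y the difference is e^(-x) (1 - e^(-(y-x))), and 1 - e^(-t) <= t. *)
Lemma expRN_lipschitz (m x y : R) : m <= x -> m <= y ->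
  `|expR (- x) - expR (- y)| <= `|x - y| * expR (- m).
Proof.
wlog xy : x y / x <= y => [H mx my|mx _].
  have [xy|yx] := leP x y; first exact: H.
  by rewrite distrC (distrC x); apply: H => //; exact: ltW.
rewrite ger0_norm ?subr_ge0 ?ler_expR ?lerN2// distrC ger0_norm ?subr_ge0//.
have -> : expR (- x) - expR (- y) = (1 - expR (- (y - x))) * expR (- x).
  by rewrite mulrBl mul1r -expRD; congr (_ - expR _); ring.
apply: ler_pM; rewrite ?expR_ge0 ?ler_expR ?lerN2//.
  by rewrite subr_ge0 -expR0 ler_expR oppr_le0 subr_ge0.
by have := expR_ge1Dx (- (y - x)); lra.
Qed.

(* The factor [1 + K / kappa] absorbs [kappa * x <= expR (kappa * x)]. *)
Lemma laplace_integrand_near (g A x y K eta delta kappa : R) :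
  0 < kappa -> delta = 1 - 2 * kappa -> 0 <= x -> 0 <= eta -> `|A| <= K ->
  `|g - A| <= eta -> `|y - x| <= eta * x -> `|y - x| <= delta * x -> 0 <= delta ->
  `|g * expR (- y) - A * expR (- x)| <= eta * (1 + K / kappa) * expR (- (kappa * x)).
Proof.
move=> k0 dk x0 eta0 AK gA yx1 yx2 d0.
have K0 : 0 <= K by apply: le_trans AK.
(* Since 1 - delta = 2 kappa, both exponents are at least 2 kappa x. One kappa x stays in the final
   bound; the other pays for the factor x produced by the Lipschitz estimate. *)
have mx : 2 * kappa * x <= x by rewrite ler_piMl//; lra.
have my : 2 * kappa * x <= y.
  move: yx2; rewrite ler_norml dk => /andP[+ _]; rewrite mulrBl; lra.
(* The first summand carries the error of the amplitude, the second that of the exponent. *)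
have -> : g * expR (- y) - A * expR (- x) =
  (g - A) * expR (- y) + A * (expR (- y) - expR (- x)) by ring.
apply: le_trans (ler_normD _ _) _; rewrite !normrM (ger0_norm (expR_ge0 _)).
have e1 : `|g - A| * expR (- y) <= eta * expR (- (kappa * x)).
  apply: ler_pM; rewrite ?expR_ge0// ler_expR lerN2 (le_trans _ my)//.
  by rewrite -mulrA ler_peMl ?mulr_ge0 ?(ltW k0)//; lra.
have e2 : `|A| * `|expR (- y) - expR (- x)| <=
    K * (eta / kappa * expR (- (kappa * x))).
  apply: ler_pM => //; apply: le_trans (expRN_lipschitz my mx) _.
  apply: (@le_trans _ _ (eta * x * expR (- (2 * kappa * x)))).
    by rewrite ler_wpM2r ?expR_ge0.
  rewrite -!mulrA ler_wpM2l// mulrC ler_pdivlMl//.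
  have -> : - (2 * (kappa * x)) = - (kappa * x) - kappa * x by ring.
  have -> : kappa * (expR (- (kappa * x) - kappa * x) * x) =
    kappa * x * expR (- (kappa * x)) * expR (- (kappa * x)) by rewrite expRD; ring.
  rewrite ler_piMl ?expR_ge0// expRN ler_pdivrMr ?expR_gt0// mul1r.
  by have := expR_ge1Dx (kappa * x); lra.
apply: le_trans (lerD e1 e2) _; rewrite le_eqVlt; apply/orP; left; apply/eqP.
by field; exact: lt0r_neq0.
Qed.

(** Here [g] need not be close to [A]: each of the two terms is separately of size K e^(-2 kappa x),
    because both exponents are at least 2 kappa x. *)
Lemma laplace_integrand_far (g A x y K delta kappa : R) :
  0 < kappa -> delta = 1 - 2 * kappa -> 0 <= x -> 0 <= delta -> `|A| <= K ->
  `|g| <= K -> `|y - x| <= delta * x ->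
  `|g * expR (- y) - A * expR (- x)| <= 2 * K * expR (- (2 * kappa * x)).
Proof.
move=> k0 dk x0 d0 AK gK yx.
have mx : 2 * kappa * x <= x by rewrite ler_piMl//; lra.
have my : 2 * kappa * x <= y.
  move: yx; rewrite ler_norml dk => /andP[+ _]; rewrite mulrBl; lra.
apply: le_trans (ler_normB _ _) _; rewrite !normrM !(ger0_norm (expR_ge0 _)).
rewrite -mulrA mulrDl mul1r.
by apply: lerD; apply: ler_pM; rewrite ?expR_ge0// ler_expR lerN2.
Qed.

Lemma integrable_radial_model (d : nat) (a b : R) : (0 < d)%N -> 0 < a -> 0 < b ->
  mu.-integrable (`]0, +oo[ : set R) (fun r : R => (expR (- (b * r `^ a)) * r ^+ d.-1)%:E).
Proof.
move=> d0 a0 b0; apply/integrableP; split.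
  apply/measurable_EFinP; apply: continuous_gt0_measurable => r r0.
  apply: cvgM; last exact: exprn_continuous.
  apply: (@continuous_comp _ _ _ (fun r : R => - (b * r `^ a)) expR); last exact: continuous_expR.
  by apply: cvgN; apply: cvgM; [exact: cvg_cst|exact: continuous_powR].
have -> : (\int[mu]_(r in `]0%R, +oo[) `|(expR (- (b * r `^ a)) * r ^+ d.-1)%:E| =
    \int[mu]_(r in `]0%R, +oo[) (expR (- (b * r `^ a)) * r ^+ d.-1)%:E)%E.
  apply: eq_integral => r; rewrite inE/= in_itv/= andbT => r0.
  by rewrite ger0_norm// mulr_ge0 ?expR_ge0 ?exprn_ge0 ?ltW.
by rewrite integral_radial_model// ltry.
Qed.

Lemma Rintegral_radial_model (d : nat) (a b : R) : (0 < d)%N -> 0 < a -> 0 < b ->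
  \int[mu]_(r in `]0, +oo[) (expR (- (b * r `^ a)) * r ^+ d.-1) =
  a^-1 * b `^ (- (d%:R / a)) * gamma (d%:R / a).
Proof. by move=> d0 a0 b0; rewrite /Rintegral integral_radial_model. Qed.

(** [G] plays the amplitude, [phi] the excess of f over its minimum, and [A] the limit of [G] at 0.
    The bound is explicit in every constant, so that one choice of [rho], [eta] and [z] can later
    serve all rays. *)
Lemma radial_estimate (d : nat) (G phi : R -> R)
    (A K z c a eps rho eta delta kappa : R) :
  (0 < d)%N -> 0 < z -> 0 < c -> 0 < a -> 0 < rho -> rho <= eps -> 0 <= eta ->
  0 <= delta -> 0 < kappa -> delta = 1 - 2 * kappa ->
  measurable_fun (`]0, eps[ : set R) G -> measurable_fun (`]0, eps[ : set R) phi ->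
  `|A| <= K ->
  (forall r : R, 0 < r < eps -> `|G r| <= K) ->
  (forall r : R, 0 < r < rho -> `|G r - A| <= eta) ->
  (forall r : R, 0 < r < eps -> `|phi r - c * r `^ a| <= delta * (c * r `^ a)) ->
  (forall r : R, 0 < r < rho -> `|phi r - c * r `^ a| <= eta * (c * r `^ a)) ->
  `| z `^ (d%:R / a) *
       \int[mu]_(r in `]0, eps[) (G r * expR (- (z * phi r)) * r ^+ d.-1)
     - A * (a^-1 * c `^ (- (d%:R / a)) * gamma (d%:R / a)) |
  <= (eta * (1 + K / kappa) + 2 * K * expR (- (kappa * (z * (c * rho `^ a)))))
     * (a^-1 * (kappa * c) `^ (- (d%:R / a)) * gamma (d%:R / a)).
Proof.
move=> d0 z0 c0 a0 rho0 rhoeps eta0 delta0 k0 dk mG mphi AK GK Gnear phifar phinear.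
have K0 : 0 <= K by apply: le_trans AK.
pose D : set R := `]0, +oo[%classic; pose E : set R := `]0, eps[%classic.
have DE : D `&` E = E.
  by apply/setIidPr => r; rewrite /D /E /= !in_itv/= andbT => /andP[].
pose h (r : R) := G r * expR (- (z * phi r)) * r ^+ d.-1.
pose w (b r : R) := expR (- (b * r `^ a)) * r ^+ d.-1 : R.
pose x := d%:R / a.
(* One constant for both zones: the first term comes from r < rho, the second is the value at r =
   rho of the exponential spared in the far zone. *)
pose Q := eta * (1 + K / kappa) + 2 * K * expR (- (kappa * (z * (c * rho `^ a)))).
have zc0 : 0 < z * c by rewrite mulr_gt0.
have kzc0 : 0 < kappa * (z * c) by rewrite mulr_gt0.
have Kk0 : 0 <= K / kappa by rewrite divr_ge0 ?(ltW k0).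
have Q0 : 0 <= Q.
  by rewrite addr_ge0 ?mulr_ge0 ?expR_ge0 ?addr_ge0 ?ler01 ?ler0n.
have mE : measurable E by exact: measurable_itv.
have mD : measurable D by exact: measurable_itv.
have mh : measurable_fun E h.
  apply: measurable_funM; last by apply: measurable_funTS; exact: measurable_funX.
  apply: measurable_funM => //; apply: measurableT_comp => //.
  apply: measurableT_comp; first exact: oppr_measurable.
  by apply: measurable_funM.
(* Extending [h] by 0 beyond [eps] puts it on the same half line as the model, whose integral is
   known exactly there. *)
have mhD : measurable_fun D (h \_ E) by apply/measurable_restrict; rewrite ?DE.
have iw (b : R) : 0 < b -> mu.-integrable D (EFin \o w b) by exact: integrable_radial_model.
have iZ (k b : R) : 0 < b -> mu.-integrable D (EFin \o (fun r => k * w b r)).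
  move=> b0; rewrite [X in integrable _ _ X](_ : _ = (fun r => k%:E * (EFin \o w b) r)%E) //.
  by apply: integrableZl => //; exact: iw.
have iQw := iZ Q _ kzc0; have iAw := iZ A _ zc0.
have bound (r : R) : D r -> `|(h \_ E) r - A * w (z * c) r| <= Q * w (kappa * (z * c)) r.
  rewrite /D /= in_itv/= andbT => r0.
  pose X := z * (c * r `^ a); pose Y := z * phi r.
  have cra0 : 0 <= c * r `^ a by rewrite mulr_ge0 ?powR_ge0 ?ltW.
  have X0 : 0 <= X by rewrite mulr_ge0// ltW.
  have wE : w (z * c) r = expR (- X) * r ^+ d.-1 by rewrite /w /X mulrA.
  have wkE : w (kappa * (z * c)) r = expR (- (kappa * X)) * r ^+ d.-1.
    by rewrite /w /X !mulrA.
  have rd0 : 0 <= r ^+ d.-1 by rewrite exprn_ge0// ltW.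
  have XY (s : R) : `|phi r - c * r `^ a| <= s * (c * r `^ a) -> `|Y - X| <= s * X.
    move=> H; rewrite /X /Y -mulrBr normrM gtr0_norm// mulrCA ler_pM2l//.
  rewrite wE wkE mulrA [leRHS]mulrA.
  (* Half of the rate 2 kappa X is kept for the majorant. The other half is largest at r = rho,
     because r^a increases, and is absorbed into [Q]. *)
  have farQ : rho <= r -> 2 * K * expR (- (2 * kappa * X)) <= Q * expR (- (kappa * X)).
    move=> rr; rewrite /Q [leRHS]mulrDl.
    apply: (@le_trans _ _ (2 * K * expR (- (kappa * (z * (c * rho `^ a)))) * expR (- (kappa * X)))).
      rewrite -[leRHS]mulrA ler_wpM2l ?mulr_ge0//.
      rewrite -expRD ler_expR -opprD lerN2.
      have -> : 2 * kappa * X = kappa * X + kappa * X by ring.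
      rewrite lerD2r ler_pM2l// /X ler_pM2l// ler_pM2l//.
      by apply: ge0_ler_powR; rewrite ?nnegrE ?(ltW a0) ?(ltW rho0) ?(ltW r0).
    by rewrite lerDr !mulr_ge0 ?expR_ge0 ?addr_ge0.
  (* Beyond [eps] the extended integrand vanishes, and the far estimate applies with g = 0 and y =
     x. *)
  have [re|re] := ltP r eps; last first.
    rewrite patchE memNset ?sub0r; last first.
      by rewrite /E /= in_itv/= r0/= => /(le_lt_trans re); rewrite ltxx.
    rewrite normrN normrM (ger0_norm rd0) ler_wpM2r//.
    apply: le_trans (farQ (le_trans rhoeps re)).
    have := @laplace_integrand_far 0 A X X K delta kappa k0 dk X0 delta0 AK.
    by rewrite mul0r sub0r normrN subrr normr0; apply => //; rewrite mulr_ge0.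
  have rE : 0 < r < eps by rewrite r0.
  rewrite patchE mem_set; last by rewrite /E /= in_itv.
  rewrite /h -mulrBl normrM (ger0_norm rd0) ler_wpM2r//.
  have [rr|rr] := ltP r rho; last first.
    apply: le_trans (farQ rr).
    apply: (laplace_integrand_far k0 dk) => //; [exact: GK|exact/XY/phifar].
  have rR : 0 < r < rho by rewrite r0.
  apply: (@le_trans _ _ (eta * (1 + K / kappa) * expR (- (kappa * X)))).
    apply: (laplace_integrand_near k0 dk) => //.
    - exact: Gnear.
    - exact/XY/phinear.
    - exact/XY/phifar.
  by rewrite ler_wpM2r ?expR_ge0// /Q lerDl !mulr_ge0 ?expR_ge0.
have iB : mu.-integrable D (EFin \o (fun r => (h \_ E) r - A * w (z * c) r)).
  apply: le_integrable iQw => //.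
    apply/measurable_EFinP; apply: measurable_funB => //.
    by have /integrableP[/measurable_EFinP] := iAw.
  by move=> r Dr; rewrite lee_fin; apply: le_trans (bound _ Dr) _; rewrite ler_norm.
(* The difference is dominated and the model is integrable, so their sum is integrable. *)
have ihD : mu.-integrable D (EFin \o (h \_ E)).
  pose u (r : R) := (h \_ E) r - A * w (z * c) r; pose v (r : R) := A * w (z * c) r.
  rewrite [X in integrable _ _ X](_ : _ = (EFin \o u) \+ (EFin \o v))%E.
    exact: integrableD.
  by apply/funext => r /=; rewrite -EFinD subrK.
have IhE : \int[mu]_(r in E) h r = \int[mu]_(r in D) (h \_ E) r.
  by rewrite -Rintegral_mkcondr DE.
(* The prefactor z^(d/a) cancels the power of [z] exactly, both in the model and in the majorant;
   only c and kappa c are left. *)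
have zx (b : R) : 0 < b -> z `^ x * (z * b) `^ (- x) = b `^ (- x).
  move=> b0; rewrite powRM ?(ltW z0) ?(ltW b0)// mulrA -powRD ?subrr ?powRr0 ?mul1r//.
  by rewrite (gt_eqF z0) implybT.
have Aw : \int[mu]_(r in D) (A * w (z * c) r) =
    A * (a^-1 * (z * c) `^ (- x) * gamma x).
  by rewrite RintegralZl ?Rintegral_radial_model//; exact: iw.
have Qw : \int[mu]_(r in D) (Q * w (kappa * (z * c)) r) =
    Q * (a^-1 * (z * (kappa * c)) `^ (- x) * gamma x).
  rewrite RintegralZl ?Rintegral_radial_model//; last exact: iw.
  by rewrite (mulrCA kappa).
have main : `|\int[mu]_(r in D) ((h \_ E) r - A * w (z * c) r)| <=
    \int[mu]_(r in D) (Q * w (kappa * (z * c)) r).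
  apply: le_trans (le_normr_Rintegral _ iB) _ => //.
  by apply: le_Rintegral => //; exact: (integrable_norm iB).
rewrite RintegralB// Aw Qw -IhE in main.
have zx0 : 0 < z `^ x by rewrite powR_gt0.
rewrite -/x -[X in A * (_ * X * _)](zx _ c0).
rewrite -(zx (kappa * c)) ?mulr_gt0//.
have -> : z `^ x * \int[mu]_(r in `]0, eps[) (G r * expR (- (z * phi r)) * r ^+ d.-1) -
  A * (a^-1 * (z `^ x * (z * c) `^ (- x)) * gamma x) =
  z `^ x * (\int[mu]_(r in E) h r - A * (a^-1 * (z * c) `^ (- x) * gamma x)).
  by rewrite -/E -/(h _); ring.
rewrite normrM (gtr0_norm zx0).
apply: le_trans (ler_wpM2l (ltW zx0) main) _.
rewrite -/Q le_eqVlt; apply/orP; left; apply/eqP.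
move: (Q) (gamma x) (powR _ (- x)) => q g p; ring.
Qed.

End radial_estimate.

(** * Lebesgue and sphere measure *)

Section euclidean_measure.
Context {R : realType}.

Lemma enormZ n (r : R) (x : 'rV[R]_n) : 0 <= r -> enorm (r *: x) = r * enorm x.
Proof.
move=> r0; rewrite /enorm; under eq_bigr do rewrite mxE exprMn.
by rewrite -mulr_sumr sqrtrM ?sqr_ge0// sqrtr_sqr ger0_norm.
Qed.

Lemma enorm_coord n (x : 'rV[R]_n) i : `|x 0 i| <= enorm x.
Proof.
rewrite -sqrtr_sqr ler_sqrt ?sumr_ge0// => [|j _]; last exact: sqr_ge0.
by rewrite (bigD1 i)//= lerDl sumr_ge0// => j _; exact: sqr_ge0.
Qed.

(** A box that contains the unit ball and whose measure can be bounded by induction on the dimension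
    through the product structure. *)
Definition unit_box n : set (borel 'rV[R]_n) :=
  [set x | forall i, `|(x : 'rV[R]_n) 0 i| <= 1].

Lemma measurable_unit_box n : measurable (@unit_box n).
Proof.
have -> : @unit_box n = \bigcap_(i : 'I_n)
    ((fun x : borel 'rV[R]_n => (x : 'rV[R]_n) 0 i) @^-1` `[-1, 1]).
  apply/seteqP; split => [x h i _|x h i] /=.
    by rewrite in_itv/= -ler_norml.
  by have := h i I; rewrite /= in_itv/= -ler_norml.
apply: fin_bigcap_measurable => // i _.
by rewrite -[X in measurable X]setTI; exact: rV_coord_measurable.
Qed.

Lemma lebesgue_rV_unit_box n : (lebesgue_rV R n (@unit_box n) < +oo)%E.
Proof.
elim: n => [|n IHn]; first by rewrite /= /dirac indicE; case: (_ \in _); exact: ltry.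
rewrite /= /lebesgue_rVS /image_measure /pushforward.
apply: (@le_lt_trans _ _ ((@lebesgue_measure R \x lebesgue_rV R n)%E
    (`[-1, 1]%classic `*` @unit_box n))).
  apply: le_measure; rewrite ?inE.
  - rewrite -[X in measurable X]setTI; apply: measurable_rV_cons => //.
    exact: measurable_unit_box.
  - by apply: measurableX => //; exact: measurable_unit_box.
  - move=> [t x] /= h; split => /=.
      by have := h ord0; rewrite /rV_cons mxE unlift_none in_itv/= -ler_norml.
    by move=> i; have := h (lift ord0 i); rewrite /rV_cons mxE liftK.
rewrite product_measure1E//; last exact: measurable_unit_box.
rewrite lte_mul_pinfty//.
  suff : lebesgue_measure (`[-1, 1]%classic : set R) \is a fin_num by [].
  by rewrite lebesgue_measure_itv/=; case: ifP.
Qed.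

(** By construction the measure of [A] is n times the volume of a part of the unit ball, which lies
    in the unit box. *)
Lemma sphere_measure_lty n (A : set (borel 'rV[R]_n)) : measurable A ->
  (sphere_measure R n A < +oo)%E.
Proof.
move=> mA; rewrite /sphere_measure /mscale /image_measure /pushforward /mrestr /=.
rewrite lte_mul_pinfty// ?lee_fin//; apply: le_lt_trans (@lebesgue_rV_unit_box n).
apply: le_measure; rewrite ?inE.
- apply: measurableI; last exact: measurable_eball.
  by rewrite -[X in measurable X]setTI; exact: measurable_direction.
- exact: measurable_unit_box.
- by move=> x [_ /ltW x1] i; exact: le_trans (enorm_coord _ _) x1.
Qed.

Lemma measurable_rV_scale n :
  measurable_fun setT (fun x : measurableTypeR R * borel 'rV[R]_n =>
    (x.1 *: (x.2 : 'rV[R]_n)) : borel 'rV[R]_n).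
Proof.
apply: rV_borelP => i; under eq_fun do rewrite mxE.
apply: measurable_funM; first exact: measurable_fst.
by apply: (measurableT_comp (@rV_coord_measurable R n i)); exact: measurable_snd.
Qed.

End euclidean_measure.

(** * Measurability of integrals along rays *)

Lemma measurable_fun_parametric_Rintegral d1 d2 (T1 : measurableType d1)
    (T2 : measurableType d2) (R : realType)
    (mu : {sigma_finite_measure set T1 -> \bar R}) (f : T1 * T2 -> R) :
  measurable_fun setT f -> measurable_fun setT (fun y => \int[mu]_x f (x, y)).
Proof.
(* The integral is the finite part of a difference of two Tonelli integrals, one for each sign, so
   integrability of [f] is not at stake. *)
move=> mf; have mEf : measurable_fun setT (EFin \o f) by exact/measurable_EFinP.
apply: (measurableT_comp (fine_measurable measurableT)).
rewrite (_ : (fun y => _) = (fun y => fubini_G mu (EFin \o f)^\+ y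
    - fubini_G mu (EFin \o f)^\- y)%E); last first.
  apply/funext => y; rewrite [LHS]integralE /fubini_G /=; congr (_ - _)%E;
    by apply: eq_integral => x _; rewrite ?funeposE ?funenegE.
by apply: emeasurable_funB; apply: measurable_fun_fubini_tonelli_G => //;
  [exact: measurable_funepos|exact: measurable_funeneg].
Qed.

Section radial_measurability.
Context {R : realType} (n : nat).
Local Notation mu := (@lebesgue_measure R).
Context (D S : set (borel 'rV[R]_n)) (eps : R) (H : borel 'rV[R]_n -> R)
  (mD : measurable D) (mH : measurable_fun D H)
  (DS : forall (r : R) theta, S theta -> 0 < r < eps -> D (r *: (theta : 'rV[R]_n))).

Lemma measurable_radial_section theta : S theta ->
  measurable_fun (`]0, eps[ : set (measurableTypeR R))
    (fun r => H (r *: (theta : 'rV[R]_n))).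
Proof.
move=> St; apply: (measurable_comp (F := D) (g := fun r : measurableTypeR R =>
  (r *: (theta : 'rV[R]_n)) : borel 'rV[R]_n)) => //.
  by move=> _ [r /= + <-]; rewrite in_itv/=; exact: DS.
apply: measurable_funTS; apply: rV_borelP => i.
under eq_fun do rewrite mxE.
by apply: measurable_funM; [exact: measurable_id|exact: measurable_cst].
Qed.

Lemma measurable_radial_integral (d : nat) : measurable S ->
  measurable_fun S
    (fun theta => \int[mu]_(r in `]0, eps[) (H (r *: (theta : 'rV[R]_n)) * r ^+ d)).
Proof.
(* [H] is measurable on [D] only. Extended by 0 and cut off by the indicator of the radial interval,
   it becomes measurable on the whole product. *)
move=> mS; pose f (x : measurableTypeR R * borel 'rV[R]_n) :=
  (H \_ D) (x.1 *: (x.2 : 'rV[R]_n)) * x.1 ^+ d * \1_(`]0, eps[%classic) x.1.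
have mf : measurable_fun setT f.
  apply: measurable_funM; last first.
    apply: measurableT_comp; last exact: measurable_fst.
    exact: measurable_indic.
  apply: measurable_funM; last exact: measurable_funX.
  apply: (measurableT_comp (f := H \_ D) _ (@measurable_rV_scale R n)).
  by apply/(measurable_restrictT _ mD).
apply: eq_measurable_fun (measurable_funTS (measurable_fun_parametric_Rintegral mu mf)).
move=> theta; rewrite inE => St; rewrite [RHS]Rintegral_mkcond.
apply: eq_Rintegral => r _; rewrite /f indicE /= [RHS]patchE.
case: ifPn => [rE|rE]; last by rewrite mulr0.
rewrite mulr1 patchE mem_set//; apply: DS => //.
by move: rE; rewrite inE/= in_itv.
Qed.

End radial_measurability.

(** * Uniform asymptotics *)

Lemma at_right0P (R : realType) (P : R -> Prop) :
  (\forall r \near 0^'+, P r) <-> exists2 rho : R, 0 < rho & forall r, 0 < r < rho -> P r.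
Proof.
split=> [|[rho rho0 rhoP]].
  rewrite /at_right near_withinE => /nbhs_ballP[rho /= rho0 rhoP].
  exists rho => // r /andP[r0 rrho]; apply: rhoP => //=.
  by rewrite /ball/= sub0r normrN gtr0_norm.
near=> r; apply: rhoP; apply/andP; split; near: r.
  exact: nbhs_right_gt.
exact: nbhs_right_lt.
Unshelve. all: by end_near. Qed.

(** The bridge between suprema in the extended reals and estimates valid at all points at once. The
    0 inside [usup] keeps the supremum nonnegative even for empty [S]. *)
Lemma usup_cvg0P (R : realType) (I T : Type) (F : set_system I) (FF : ProperFilter F)
    (S : set T) (h : I -> T -> R) :
  usup S (h i) @[i --> F] --> 0%E <->
  forall e : R, 0 < e -> \forall i \near F, forall x, S x -> h i x <= e.
Proof.
have sup0 i : (0 <= usup S (h i))%E by apply: ereal_sup_ubound; left.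
split=> [cv e e0|H].
  have : \forall i \near F, (usup S (h i) < e%:E)%E.
    apply: (cv [set y | (y < e%:E)%E]); apply: open_nbhs_nbhs; split.
      exact: open_ereal_lt_ereal.
    by rewrite /= lte_fin.
  apply: filterS => i hi x Sx; rewrite -lee_fin; apply: le_trans (ltW hi).
  by apply: ereal_sup_ubound; right; exists x.
have H' e : 0 < e -> \forall i \near F, (usup S (h i) <= e%:E)%E.
  move=> e0; apply: filterS (H _ e0) => i hi.
  apply: ge_ereal_sup => _ [->|[x Sx <-]]; rewrite lee_fin ?(ltW e0)//; exact: hi.
apply/fine_cvgP; split.
  apply: filterS (H' 1 ltr01) => i hi.
  by rewrite ge0_fin_numE//; apply: le_lt_trans hi _; exact: ltry.
apply/cvgrPdist_le => e e0; apply: filterS (H' e e0) => i hi.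
rewrite sub0r normrN ger0_norm ?fine_ge0//.
by rewrite -lee_fin fineK// ge0_fin_numE//; apply: le_lt_trans hi _; exact: ltry.
Qed.

Section uniform_asymptotics.
Context {R : realType}.
Local Notation mu := (@lebesgue_measure R).

(** A crude bound at fixed [z]: the exponential is at most 1, so the supremum times the length
    suffices. It supplies boundedness in the direction for the integral over the sphere. *)
Lemma radial_integral_bounded (d : nat) (G phi : R -> R) (K z eps : R) :
  0 < z -> 0 < eps ->
  measurable_fun (`]0, eps[ : set R) G -> measurable_fun (`]0, eps[ : set R) phi ->
  (forall r : R, 0 < r < eps -> `|G r| <= K) ->
  (forall r : R, 0 < r < eps -> 0 <= phi r) ->
  mu.-integrable (`]0, eps[ : set R)
    (fun r => (G r * expR (- (z * phi r)) * r ^+ d)%:E) /\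
  `|\int[mu]_(r in `]0, eps[) (G r * expR (- (z * phi r)) * r ^+ d)| <=
    K * eps ^+ d * eps.
Proof.
move=> z0 eps0 mG mphi GK phi0.
pose h (r : R) := G r * expR (- (z * phi r)) * r ^+ d.
pose E : set R := `]0, eps[%classic.
have mE : measurable E by exact: measurable_itv.
have K0 : 0 <= K.
  by apply: le_trans (GK (eps / 2) _) => //; rewrite divr_gt0//= gtr_pMr// invf_lt1// ltr1n.
have Eeps : mu E = eps%:E.
  by rewrite lebesgue_measure_itv/= lte_fin eps0 sube0.
have Elty : (mu E < +oo)%E by rewrite Eeps ltry.
have mh : measurable_fun E h.
  apply: measurable_funM; last by apply: measurable_funTS; exact: measurable_funX.
  apply: measurable_funM => //; apply: measurableT_comp => //.
  apply: measurableT_comp; first exact: oppr_measurable.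
  by apply: measurable_funM.
have hK r : E r -> `|h r| <= K * eps ^+ d.
  rewrite /E /= in_itv/= => rE; have /andP[r0 re] := rE.
  rewrite /h !normrM; apply: ler_pM => //.
    rewrite -[K]mulr1; apply: ler_pM => //; first exact: GK.
    by rewrite ger0_norm ?expR_ge0// -expR0 ler_expR oppr_le0 mulr_ge0 ?phi0// ltW.
  by rewrite normrX gtr0_norm// lerXn2r ?nnegrE ?ltW.
have ih : mu.-integrable E (EFin \o h).
  apply: measurable_bounded_integrable => //.
  exists (K * eps ^+ d); split; first exact: num_real.
  by move=> x Kx r Er /=; apply: le_trans (ltW Kx); exact: hK.
have icst : mu.-integrable E (EFin \o cst (K * eps ^+ d)).
  apply: measurable_bounded_integrable => //.
  exists `|K * eps ^+ d|; split; first exact: num_real.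
  by move=> x Kx r Er /=; exact: ltW.
split; first exact: ih.
apply: le_trans (le_normr_Rintegral _ ih) _ => //.
apply: (@le_trans _ _ (\int[mu]_(r in E) (K * eps ^+ d))).
  by apply: le_Rintegral => //; exact: (integrable_norm ih).
rewrite le_eqVlt; apply/orP; left; apply/eqP; rewrite Rintegral_cst//.
exact: (congr1 (fun t => K * eps ^+ d * fine t) Eeps).
Qed.

(** The base 1 / b <= 1 / m is enlarged to 1 + 1 / m, which is at least 1, so that its power grows
    with the exponent d / a; the Gamma factor is bounded by its endpoint values. *)
Lemma radial_constant_bound (d : nat) (m b a amin amax : R) :
  (0 < d)%N -> 0 < m -> m <= b -> 0 < amin -> amin <= a -> a <= amax ->
  a^-1 * b `^ (- (d%:R / a)) * gamma (d%:R / a) <=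
  amin^-1 * (1 + m^-1) `^ (d%:R / amin) *
    (gamma (d%:R / amax) + gamma (d%:R / amin)).
Proof.
move=> d0 m0 mb amin0 amina aamax.
have b0 : 0 < b by apply: lt_le_trans mb.
have a0 : 0 < a by apply: lt_le_trans amina.
have amax0 : 0 < amax by apply: lt_le_trans aamax.
have dR : 0 < d%:R :> R by rewrite ltr0n.
have mV : 0 <= m^-1 by rewrite invr_ge0 ltW.
apply: ler_pM.
- by rewrite mulr_ge0 ?powR_ge0// invr_ge0 ltW.
- exact: gamma_ge0.
- apply: ler_pM; rewrite ?invr_ge0 ?powR_ge0 ?(ltW a0)//.
    by rewrite lef_pV2 ?posrE.
  apply: (@le_trans _ _ ((m^-1) `^ (d%:R / a))).
    rewrite -(powR_inv1 (ltW m0)) -powRrM mulN1r !powRN lef_pV2 ?posrE ?powR_gt0//.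
    by apply: ge0_ler_powR; rewrite ?nnegrE ?(ltW m0) ?(ltW b0)// divr_ge0 ?ltW.
  apply: (@le_trans _ _ ((1 + m^-1) `^ (d%:R / a))).
    apply: ge0_ler_powR; rewrite ?nnegrE ?addr_ge0 ?lerDr//.
    by rewrite divr_ge0 ?ltW.
  apply: ler_powR; first by rewrite lerDl.
  by rewrite ler_pM2l// lef_pV2 ?posrE.
- apply: gamma_le_endpoints; first by rewrite divr_gt0.
    by rewrite ler_pM2l// lef_pV2 ?posrE.
  by rewrite ler_pM2l// lef_pV2 ?posrE.
Qed.

(** [radial_estimate] with constants chosen in an order free of [x]: [eta] from [e] and the bound
    [B], then [rho] from [eta], then the threshold for [z] from [rho]. *)
Lemma uniform_radial_asymptotics (T : Type) (S : set T) (d : nat)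
    (eps K cmin amin amax delta0 : R) (c a A : T -> R) (G phi : T -> R -> R) :
  (0 < d)%N -> 0 < eps -> 0 < cmin -> 0 < amin -> delta0 < 1 ->
  (forall x, S x -> cmin <= c x) -> (forall x, S x -> amin <= a x <= amax) ->
  (forall x, S x -> measurable_fun (`]0, eps[ : set R) (G x)) ->
  (forall x, S x -> measurable_fun (`]0, eps[ : set R) (phi x)) ->
  (forall x (r : R), S x -> 0 < r < eps -> `|G x r| <= K) ->
  (forall e : R, 0 < e -> \forall r \near 0^'+,
    forall x, S x -> `|G x r - A x| <= e) ->
  (forall x (r : R), S x -> 0 < r < eps ->
    `|phi x r - c x * r `^ a x| <= delta0 * (c x * r `^ a x)) ->
  (forall e : R, 0 < e -> \forall r \near 0^'+,
    forall x, S x -> `|phi x r - c x * r `^ a x| <= e * (c x * r `^ a x)) ->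
  forall e : R, 0 < e -> \forall z \near +oo, forall x, S x ->
    `|z `^ (d%:R / a x) *
        \int[mu]_(r in `]0, eps[) (G x r * expR (- (z * phi x r)) * r ^+ d.-1)
      - A x * ((a x)^-1 * c x `^ (- (d%:R / a x)) * gamma (d%:R / a x))| <= e.
Proof.
move=> d0 eps0 cmin0 amin0 delta01 hc ha mG mphi GK Gnear phifar phinear e e0.
(* The maximum supplies the nonnegative [delta] that [radial_estimate] asks for, and [kappa] solves
   delta = 1 - 2 kappa. *)
pose delta := Num.max delta0 0; pose kappa := (1 - delta) / 2.
have delta_ge0 : 0 <= delta by rewrite le_max lexx orbT.
have delta_lt1 : delta < 1 by rewrite gt_max delta01 ltr01.
have kappa0 : 0 < kappa by rewrite divr_gt0 ?subr_gt0.
have deltaE : delta = 1 - 2 * kappa by rewrite /kappa; field.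
clearbody kappa.
(* [A x] lies within 1 of [G x r] for small r, so [K1] bounds both. *)
pose K1 : R := `|K| + 1; have K10 : 0 < K1 by rewrite ltr_wpDl.
have AK x : S x -> `|A x| <= K1.
  move=> Sx; have /at_right0P[rho rho0 rhoP] := Gnear 1 ltr01.
  pose r := Num.min rho eps / 2.
  have m0 : 0 < Num.min rho eps by rewrite lt_min rho0.
  have r0 : 0 < r by rewrite divr_gt0.
  have : r < Num.min rho eps by rewrite gtr_pMr// invf_lt1// ltr1n.
  rewrite lt_min => /andP[rr re].
  have h1 : `|G x r - A x| <= 1 by apply: rhoP; rewrite ?r0.
  have h2 : `|G x r| <= `|K| by apply: le_trans (ler_norm _); apply: GK; rewrite ?r0.
  have -> : A x = G x r - (G x r - A x) by ring.
  by apply: le_trans (ler_normB _ _) _; exact: lerD.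
pose B : R := amin^-1 * (1 + (kappa * cmin)^-1) `^ (d%:R / amin) *
    (gamma (d%:R / amax) + gamma (d%:R / amin)).
have B0 : 0 <= B.
  by rewrite !mulr_ge0 ?addr_ge0 ?gamma_ge0 ?powR_ge0// invr_ge0 ltW.
have B10 : 0 < B + 1 by rewrite ltr_wpDl.
pose c1 : R := 1 + K1 / kappa.
have c10 : 0 < c1 by exact: addr_gt0 ltr01 (divr_gt0 K10 kappa0).
(* Makes the near part of the constant equal to e / (2 (B + 1)); the shift to B + 1 avoids a
   division by 0. *)
pose eta : R := e / (2 * c1 * (B + 1)).
have eta0 : 0 < eta by apply: divr_gt0 => //; rewrite !mulr_gt0.
have /at_right0P[rho1 rho10 rho1P] := Gnear _ eta0.
have /at_right0P[rho2 rho20 rho2P] := phinear _ eta0.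
pose rho := Num.min (Num.min rho1 rho2) (Num.min eps 1).
have rho0 : 0 < rho by rewrite !lt_min rho10 rho20 eps0 ltr01.
have rho_eps : rho <= eps by rewrite !ge_min lexx !orbT.
have rho_1 : rho <= 1 by rewrite !ge_min lexx !orbT.
have rho_1' : rho <= rho1 by rewrite !ge_min lexx.
have rho_2' : rho <= rho2 by rewrite !ge_min lexx !orbT.
(* Because rho <= 1, the largest exponent gives the smallest power of [rho]; hence z q is a lower
   bound, on every ray, for the exponent at r = rho. *)
pose q := kappa * (cmin * rho `^ amax).
have q0 : 0 < q by do 2 (apply: mulr_gt0 => //); exact: powR_gt0.
near=> z.
have z0 : 0 < z by near: z; exact: nbhs_pinfty_gt.
have zlarge : 4 * K1 * (B + 1) / (q * e) <= z.
  by near: z; apply: nbhs_pinfty_ge; exact: num_real.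
move=> x Sx; have /andP[amina aamax] := ha _ Sx; have cminc := hc _ Sx.
have a0 : 0 < a x by apply: lt_le_trans amina.
have c0 : 0 < c x by apply: lt_le_trans cminc.
have est := @radial_estimate R d (G x) (phi x) (A x) K1 z (c x) (a x) eps rho eta delta kappa
  d0 z0 c0 a0 rho0 rho_eps (ltW eta0) delta_ge0 kappa0 deltaE (mG _ Sx) (mphi _ Sx) (AK _ Sx).
apply: le_trans (est _ _ _ _) _ => {est}.
- by move=> r rE; apply: le_trans (GK _ _ Sx rE) _; rewrite (le_trans (ler_norm _))// lerDl.
- by move=> r /andP[r0 rr]; apply: rho1P => //; rewrite r0 (lt_le_trans rr).
- move=> r rE; apply: le_trans (phifar _ _ Sx rE) _.
  rewrite ler_wpM2r ?mulr_ge0 ?powR_ge0 ?(ltW c0)//.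
  by rewrite le_max lexx.
- by move=> r /andP[r0 rr]; apply: rho2P => //; rewrite r0 (lt_le_trans rr).
have WB : (a x)^-1 * (kappa * c x) `^ (- (d%:R / a x)) * gamma (d%:R / a x) <= B.
  apply: radial_constant_bound => //; first by rewrite mulr_gt0.
  by rewrite ler_pM2l.
(* From z q <= u <= e^u one gets e^(-u) <= 1 / (z q), and the threshold on [z] is what makes this
   small enough. *)
have decay : 2 * K1 * expR (- (kappa * (z * (c x * rho `^ a x)))) <= e / (2 * (B + 1)).
  have qle : z * q <= kappa * (z * (c x * rho `^ a x)).
    rewrite /q mulrCA ler_pM2l// ler_pM2l//.
    apply: ler_pM; rewrite ?powR_ge0 ?(ltW cmin0)//.
    by apply: ger_powR; rewrite ?rho0.
  apply: (@le_trans _ _ (2 * K1 * (z * q)^-1)).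
    rewrite ler_pM2l ?mulr_gt0// expRN lef_pV2 ?posrE ?expR_gt0//; last exact: mulr_gt0.
    apply: le_trans qle _.
    by have := expR_ge1Dx (kappa * (z * (c x * rho `^ a x))); lra.
  move: zlarge; rewrite ler_pdivrMr; last exact: mulr_gt0.
  move=> zlarge; rewrite ler_pdivrMr; last exact: mulr_gt0.
  rewrite mulrAC ler_pdivlMr; last exact: mulr_gt0.
  apply: le_trans (_ : 4 * K1 * (B + 1) <= _); first by lra.
  by apply: le_trans zlarge _; lra.
have eta1 : eta * c1 = e / (2 * (B + 1)).
  by rewrite /eta; field; rewrite !lt0r_neq0.
apply: (@le_trans _ _ ((e / (2 * (B + 1)) + e / (2 * (B + 1))) * B)).
  apply: ler_pM => //.
  - apply: addr_ge0; first exact: mulr_ge0 (ltW eta0) (ltW c10).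
    by rewrite mulr_ge0 ?expR_ge0// mulr_ge0// ltW.
  - apply: mulr_ge0 (gamma_ge0 _); apply: mulr_ge0 (powR_ge0 _ _).
    by rewrite invr_ge0 ltW.
  - by rewrite -/c1 eta1 lerD2l.
have -> : (e / (2 * (B + 1)) + e / (2 * (B + 1))) * B = e * (B / (B + 1)).
  by field; rewrite lt0r_neq0.
by rewrite ler_piMr ?(ltW e0)// ler_pdivrMr// mul1r lerDl.
Unshelve. all: by end_near. Qed.

End uniform_asymptotics.

(** * Cells and normal maps *)

Section complex_parts.
Context {R : realType}.

(** The properties shared by the real and the imaginary part that the estimates use, so that each
    real estimate is made once and applied to both. *)
Definition is_part (part : R[i] -> R) : Prop :=
  [/\ forall x (y : R), part (x * y%:C) = part x * y,
      forall x y, part (x - y) = part x - part y &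
      forall x, `|part x| <= Normc.normc x].

Lemma Re_is_part : is_part (@complex.Re R).
Proof.
split=> [[x1 x2] y|[x1 x2] [y1 y2]|[x1 x2]] //=; first by rewrite mulr0 subr0.
by rewrite -sqrtr_sqr ler_sqrt ?addr_ge0 ?sqr_ge0// lerDl sqr_ge0.
Qed.

Lemma Im_is_part : is_part (@complex.Im R).
Proof.
split=> [[x1 x2] y|[x1 x2] [y1 y2]|[x1 x2]] //=; first by rewrite mulr0 add0r.
by rewrite -sqrtr_sqr ler_sqrt ?addr_ge0 ?sqr_ge0// lerDr sqr_ge0.
Qed.

Lemma normc_le_parts (x : R[i]) :
  Normc.normc x <= `|complex.Re x| + `|complex.Im x|.
Proof.
case: x => x y /=.
rewrite -[leRHS]ger0_norm ?addr_ge0// -sqrtr_sqr ler_sqrt ?sqr_ge0//.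
rewrite sqrrD !real_normK ?num_real// addrAC lerDl.
by rewrite mulrn_wge0// mulr_ge0.
Qed.

End complex_parts.

Section cells.
Context (R : realType) (n : nat) (N : riemannian R n).
Context (vol : {measure set (borel N) -> \bar R}) (l : nat).
Context (Sigma : 'I_l.+1 -> set N).
Context (volS : 'I_l.+1 -> {measure set (borel N) -> \bar R}) (M : set N).
Context (C : normal_cells vol Sigma volS M) (k : piece C).

Local Notation D p := (cell k p `&` eball (cell_radius C)).

Lemma continuous_borel_measurable (f : N -> R) :
  continuous f -> measurable_fun setT (f : borel N -> R).
Proof.
move=> cf; apply: (measurability _ (RGenOpens.measurableE R)) => _ [_ [u [v ->] <-]].
rewrite setTI; apply: sub_sigma_algebra.
by apply: open_comp => [x _|]; [exact: cf|exact: interval_open].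
Qed.

Lemma measurable_cell p : base k p -> measurable (cell k p).
Proof.
move=> kp; have := measurable_xsection p (@cell_measurable _ _ _ _ _ _ _ _ C k).
by congr measurable; apply/seteqP; split => s; rewrite /xsection /= inE/= => //; case.
Qed.

Lemma measurable_directions p : base k p -> measurable (directions k p).
Proof.
move=> kp; have -> : directions k p =
    cell k p `&` (@enorm R _ @^-1` [set 1]) by [].
apply: measurableI; first exact: measurable_cell.
by rewrite -[X in measurable X]setTI; exact: measurable_enorm.
Qed.

Lemma measurable_cell_ball p : base k p -> measurable (D p).
Proof. by move=> kp; apply: measurableI; [exact: measurable_cell|exact: measurable_eball]. Qed.

Lemma measurable_jac_section p : base k p ->
  measurable_fun (D p) (jac k p : borel 'rV[R]_(codim k) -> R).
Proof.
move=> kp; apply: (measurable_comp (F := @ndomain _ _ _ _ _ _ _ _ C k)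
  (f := fun ps => jac k ps.1 ps.2) (g := fun s : borel 'rV[R]_(codim k) => (p : borel N, s))).
- rewrite [X in measurable X](_ : _ =
    [set ps : borel N * borel 'rV[R]_(codim k) | base k ps.1 /\ cell k ps.1 ps.2] `&`
    (setT `*` eball (cell_radius C))); last first.
    by apply/seteqP; split => -[q s] [] /=; [move=> ? [] | move=> [? ?] []].
  apply: measurableI; first exact: cell_measurable.
  by apply: measurableX => //; exact: measurable_eball.
- by move=> _ [s Ds <-].
- exact: jac_measurable.
- exact: measurable_funTS (measurable_pair1 _).
Qed.

Context (hSigma : forall j : 'I_l.+1, embedded_submanifold j (Sigma j)).

(** The point p is g v for a local parametrization g of its stratum; joint continuity in (v, s) then
    gives continuity in s at fixed v. *)
Lemma measurable_nmap p : base k p ->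
  measurable_fun (eball (cell_radius C)) (nmap k p : borel 'rV[R]_(codim k) -> borel N).
Proof.
move=> kp; have [V [g [lpg [v Vv gv]]]] := hSigma (base_stratum kp).
have cnmap s : eball (cell_radius C) s -> {for s, continuous (nmap k p)}.
  move=> es; have [/(_ (v, s)) cont _] := nmap_C1 (k := k) lpg.
  have {}cont := cont (And3 Vv (eq_ind_r (base_nbhd k) (base_nbhd_sub kp) gv) es).
  rewrite -gv.
  apply: (@continuous_comp _ _ _ (fun s : 'rV[R]_(codim k) => (v, s))
    (fun vs : 'rV[R]_(stratum k) * 'rV[R]_(codim k) => nmap k (g vs.1) vs.2)) => //.
  move=> W [[P Q] [/= Pv Qs] PQ]; apply: filterS Qs => t Qt.
  by apply: PQ; split => //=; exact: nbhs_singleton.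
apply: measurability => [//|_ [U oU <-]].
(* Continuity at the points of the ball allows the preimage to be replaced by its interior, which is
   open and hence Borel. *)
have -> : eball (cell_radius C) `&` nmap k p @^-1` U =
    eball (cell_radius C) `&` interior (nmap k p @^-1` U).
  apply/seteqP; split => s [es sU]; split => //; last exact: interior_subset.
  by apply: (cnmap s es); apply: open_nbhs_nbhs.
apply: measurableI; first exact: measurable_eball.
by apply: sub_sigma_algebra; exact: open_interior.
Qed.

Lemma measurable_nmap_comp (b : borel N -> R) p : measurable_fun setT b ->
  base k p -> measurable_fun (D p) (fun s : borel 'rV[R]_(codim k) => b (nmap k p s)).
Proof.
move=> mb kp; apply: (measurableT_comp mb).
by apply: measurable_funS (measurable_nmap kp); [exact: measurable_eball|exact: subIsetr].
Qed.

Lemma cone_radial p (r : R) theta : is_cone (cell k p) ->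
  directions k p theta -> 0 < r < cell_radius C -> D p (r *: theta).
Proof.
move=> cone [ct t1] /andP[r0 re]; split; first exact: cone.
by rewrite /eball /= enormZ ?(ltW r0)// t1 mulr1.
Qed.

End cells.

(** * Uniform radial limit and the integral over directions *)

Theorem theorem7p2 (R : realType) (n : nat) (N : riemannian R n)
  (vol : {measure set (borel N) -> \bar R})
  (hvol : riemannian_volume n setT vol)
  (f : N -> R) (hfcont : continuous f) (hfbound : has_lbound (range f))
  (a : borel N -> R[i]) (ha : cmeasurable a)
  (f0 : R) (hf0 : f0 = inf (range f))
  (M : set N) (hM : M = [set x | f x = f0])
  (hMne : M !=set0) (hMcompact : compact M)
  (l : nat) (Sigma : 'I_l.+1 -> set N)
  (hSigma : forall j : 'I_l.+1, embedded_submanifold j (Sigma j))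
  (hSigmaM : \bigcup_j Sigma j = M) (hSigmadisj : trivIset setT Sigma)
  (volS : 'I_l.+1 -> {measure set (borel N) -> \bar R})
  (hvolS : forall j : 'I_l.+1, riemannian_volume j (Sigma j) (volS j))
  (C : normal_cells vol Sigma volS M)
  (k : piece C) (hd : (1 <= codim k)%N)
  (hcone : forall p : N, base k p -> is_cone (cell k p))
  (hpolar : forall (z : R) (p : N), 0 < z -> base k p ->
    laplace k f a z p =
    cintegral (sphere_measure R (codim k)) (directions k p)
      (laplace_radial k f a z p))
  (hjac : usup (direction_graph k)
      (fun x => `|jac k x.1 (r *: x.2) - 1|) @[r --> 0^'+] --> 0%E)
  (c alpha : N -> 'rV[R]_(codim k) -> R)
  (hcmeas : measurable_fun (direction_graph k) (fun x => c x.1 x.2))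
  (halphameas : measurable_fun (direction_graph k) (fun x => alpha x.1 x.2))
  (cmin cmax : R) (hcmin : 0 < cmin)
  (hc : forall (p : N) (theta : 'rV[R]_(codim k)),
    direction_graph k (p, theta) -> cmin <= c p theta <= cmax)
  (alphamin alphamax : R) (halphamin : 0 < alphamin)
  (halpha : forall (p : N) (theta : 'rV[R]_(codim k)),
    direction_graph k (p, theta) -> alphamin <= alpha p theta <= alphamax)
  (Rrad : N -> R -> 'rV[R]_(codim k) -> R)
  (hf : forall (p : N) (theta : 'rV[R]_(codim k)) (r : R),
    direction_graph k (p, theta) -> 0 < r < cell_radius C ->
    f (nmap k p (r *: theta)) - f0 =
    c p theta * r `^ alpha p theta * (1 + Rrad p r theta))
  (hRrad0 : forall (p : N) (theta : 'rV[R]_(codim k)),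
    direction_graph k (p, theta) -> Rrad p 0 theta = 0)
  (hRrad : usup (direction_graph k)
      (fun x => `|Rrad x.1 r x.2|) @[r --> 0^'+] --> 0%E)
  (delta0 : R) (hdelta0 : delta0 < 1)
  (hRradbound : forall (p : N) (theta : 'rV[R]_(codim k)) (r : R),
    direction_graph k (p, theta) -> 0 <= r < cell_radius C ->
    `|Rrad p r theta| <= delta0)
  (hajbound : exists K : R,
    forall (p : N) (theta : 'rV[R]_(codim k)) (r : R),
    direction_graph k (p, theta) -> 0 < r < cell_radius C ->
    Normc.normc (a (nmap k p (r *: theta)) * (jac k p (r *: theta))%:C) <= K)
  (haj : usup (direction_graph k)
      (fun x => Normc.normc (a (nmap k x.1 (r *: x.2))
                             * (jac k x.1 (r *: x.2))%:C - a x.1))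
      @[r --> 0^'+] --> 0%E) :
  let L (p : N) (theta : 'rV[R]_(codim k)) : R[i] :=
    a p * ((alpha p theta)^-1
           * c p theta `^ (- ((codim k)%:R / alpha p theta))
           * gamma ((codim k)%:R / alpha p theta))%:C in
  usup (direction_graph k)
    (fun x => Normc.normc
      ((expR (z * f0) * z `^ ((codim k)%:R / alpha x.1 x.2))%:C
       * laplace_radial k f a z x.1 x.2 - L x.1 x.2)) @[z --> +oo] --> 0%E /\
  exists delta : R -> N -> 'rV[R]_(codim k) -> R[i],
    (forall (z : R) (p : N), 0 < z -> base k p ->
      let g (theta : borel 'rV[R]_(codim k)) :=
        (z `^ (- ((codim k)%:R / alpha p theta)))%:C
        * (L p theta + delta z p theta) in
      cintegrable (sphere_measure R (codim k)) (directions k p) g /\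
      laplace k f a z p =
        (expR (- (z * f0)))%:C
        * cintegral (sphere_measure R (codim k)) (directions k p) g) /\
    usup (direction_graph k)
      (fun x => Normc.normc (delta z x.1 x.2)) @[z --> +oo] --> 0%E.
Proof.
move=> L; pose S := direction_graph k; pose d := codim k.
pose eps := cell_radius C; have eps0 : 0 < eps := cell_radius_gt0 C.
(* For a real or imaginary part, [J part z x] is that part of the radial integral with the factor
   e^(-z f0) removed, as [lrE] confirms. *)
pose G (part : R[i] -> R) (x : N * 'rV[R]_(codim k)) (r : R) :=
  part (a (nmap k x.1 (r *: x.2))) * jac k x.1 (r *: x.2).
pose phi (x : N * 'rV[R]_(codim k)) (r : R) := f (nmap k x.1 (r *: x.2)) - f0.
pose J part z x :=
  \int[lebesgue_measure]_(r in `]0, eps[) (G part x r * expR (- (z * phi x r)) * r ^+ d.-1).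
have mf : measurable_fun setT (f : borel N -> R) by exact: continuous_borel_measurable.
have mRe : measurable_fun setT (fun x : borel N => complex.Re (a x)) by case: ha.
have mIm : measurable_fun setT (fun x : borel N => complex.Im (a x)) by case: ha.
have DS p theta r : base k p -> directions k p theta -> 0 < r < eps ->
    (cell k p `&` eball eps) (r *: theta).
  by move=> kp; apply: cone_radial; exact: hcone.
have mHphi p : base k p ->
    measurable_fun (cell k p `&` eball eps)
      (fun s : borel 'rV[R]_(codim k) => f (nmap k p s) - f0).
  by move=> kp; apply: measurable_funB => //; exact: measurable_nmap_comp.
have mHG (part : R[i] -> R) p : measurable_fun setT (fun x : borel N => part (a x)) ->
    base k p -> measurable_fun (cell k p `&` eball eps)
      (fun s : borel 'rV[R]_(codim k) => part (a (nmap k p s)) * jac k p s).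
  move=> mpart kp; apply: measurable_funM; last exact: measurable_jac_section.
  exact: (measurable_nmap_comp hSigma (b := fun x => part (a x))).
have mphi x : S x -> measurable_fun (`]0, eps[ : set R) (phi x).
  case: x => p theta [/= kp dt].
  exact: (measurable_radial_section (measurable_cell_ball kp) (mHphi p kp)
    (fun r theta => @DS p theta r kp)).
have mG (part : R[i] -> R) x : measurable_fun setT (fun x : borel N => part (a x)) ->
    S x -> measurable_fun (`]0, eps[ : set R) (G part x).
  case: x => p theta mpart [/= kp dt].
  exact: (measurable_radial_section (measurable_cell_ball kp) (mHG part p mpart kp)
    (fun r theta => @DS p theta r kp)).
have Spair x : S x -> direction_graph k (x.1, x.2) by case: x.
have [K hK] := hajbound.
have GK part x r : is_part part -> S x -> 0 < r < eps -> `|G part x r| <= K.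
  move=> [partM _ part_le] Sx rE; rewrite /G -partM.
  by apply: le_trans (part_le _) _; apply: hK => //; exact: Spair.
have cra0 x (r : R) : S x -> 0 <= c x.1 x.2 * r `^ alpha x.1 x.2.
  case: x => p theta Sx; have /andP[cc _] := hc _ _ Sx.
  by rewrite mulr_ge0 ?powR_ge0// (le_trans (ltW hcmin)).
(* The relative error of [phi] against its model is exactly the size of [Rrad], so both hypotheses
   on [Rrad] become hypotheses on [phi]. *)
have phiB x (r : R) : S x -> 0 < r < eps ->
    `|phi x r - c x.1 x.2 * r `^ alpha x.1 x.2| =
    `|Rrad x.1 r x.2| * (c x.1 x.2 * r `^ alpha x.1 x.2).
  move=> Sx rE; rewrite /phi (hf _ _ _ (Spair _ Sx) rE).
  by rewrite mulrDr mulr1 addrAC subrr add0r normrM mulrC (ger0_norm (cra0 _ _ Sx)).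
have phifar x (r : R) : S x -> 0 < r < eps ->
    `|phi x r - c x.1 x.2 * r `^ alpha x.1 x.2| <=
    delta0 * (c x.1 x.2 * r `^ alpha x.1 x.2).
  move=> Sx rE; rewrite phiB// ler_wpM2r ?cra0//.
  apply: hRradbound; first exact: Spair.
  by have /andP[/ltW -> ->] := rE.
have phi0 x (r : R) : S x -> 0 < r < eps -> 0 <= phi x r.
  move=> Sx rE; have := phifar _ _ Sx rE; rewrite ler_norml => /andP[+ _].
  have : 0 <= (1 - delta0) * (c x.1 x.2 * r `^ alpha x.1 x.2).
    by rewrite mulr_ge0 ?cra0// subr_ge0 ltW.
  by rewrite mulrBl mul1r; lra.
have JB part z x : is_part part -> measurable_fun setT (fun x : borel N => part (a x)) ->
    0 < z -> S x ->
    lebesgue_measure.-integrable (`]0, eps[ : set R)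
      (fun r => (G part x r * expR (- (z * phi x r)) * r ^+ d.-1)%:E) /\
    `|J part z x| <= K * eps ^+ d.-1 * eps.
  move=> ppart mpart z0 Sx; apply: radial_integral_bounded => //.
  - exact: mG.
  - exact: mphi.
  - by move=> r; exact: GK.
  - by move=> r; exact: phi0.
have lrE part z x : is_part part -> measurable_fun setT (fun x : borel N => part (a x)) ->
    0 < z -> S x ->
    \int[lebesgue_measure]_(r in `]0, eps[)
      part (a (nmap k x.1 (r *: x.2)) * (jac k x.1 (r *: x.2) *
        expR (- (z * f (nmap k x.1 (r *: x.2)))) * r ^+ (codim k).-1)%:C) =
    expR (- (z * f0)) * J part z x.
  move=> ppart mpart z0 Sx; have [intJ _] := JB _ _ _ ppart mpart z0 Sx.
  rewrite -RintegralZl//; apply: eq_Rintegral => r _.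
  case: ppart => partM _ _; rewrite partM /G /phi.
  have -> : - (z * f (nmap k x.1 (r *: x.2))) =
    - (z * f0) + - (z * (f (nmap k x.1 (r *: x.2)) - f0)) by ring.
  by rewrite expRD -/d; ring.
pose E z x := expR (z * f0) * z `^ (d%:R / alpha x.1 x.2).
have key part : is_part part -> measurable_fun setT (fun x : borel N => part (a x)) ->
    forall e : R, 0 < e -> \forall z \near +oo, forall x, S x ->
    `|z `^ (d%:R / alpha x.1 x.2) * J part z x
      - part (a x.1) * ((alpha x.1 x.2)^-1 * c x.1 x.2 `^ (- (d%:R / alpha x.1 x.2)) *
          gamma (d%:R / alpha x.1 x.2))| <= e.
  move=> ppart mpart.
  apply: (@uniform_radial_asymptotics R _ S d eps K cmin alphamin alphamax delta0
    (fun x => c x.1 x.2) (fun x => alpha x.1 x.2) (fun x => part (a x.1)) (G part) phi) => //.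
  - by case=> p theta Sx; have /andP[] := hc _ _ Sx.
  - by case=> p theta; exact: halpha.
  - by move=> x; exact: mG.
  - by move=> x r; exact: GK.
  - move=> e e0; have /usup_cvg0P/(_ e e0) := haj.
    apply: filterS => r H x Sx; apply: le_trans (H x Sx).
    by case: ppart => partM partB part_le; rewrite /G -partM -partB; exact: part_le.
  - move=> e e0; have /usup_cvg0P/(_ e e0)/at_right0P[rho rho0 rhoP] := hRrad.
    (* The expansion of f holds only inside the cell radius, whence the minimum with [eps]. *)
    apply/at_right0P; exists (Num.min rho eps); first by rewrite lt_min rho0.
    move=> r; rewrite lt_min => /and3P[r0 rr re] x Sx.
    by rewrite phiB ?r0// ler_wpM2r ?cra0// rhoP ?r0.
pose delta z p theta : R[i] := (E z (p, theta))%:C * laplace_radial k f a z p theta - L p theta.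
have expK z : expR (z * f0) * expR (- (z * f0)) = 1 by rewrite -expRD subrr expR0.
have lim : usup (direction_graph k) (fun x => Normc.normc (delta z x.1 x.2)) @[z --> +oo] --> 0%E.
  apply/usup_cvg0P => e e0; have e20 : 0 < e / 2 by rewrite divr_gt0.
  have kRe := key _ Re_is_part mRe _ e20; have kIm := key _ Im_is_part mIm _ e20.
  near=> z; have z0 : 0 < z by near: z; exact: nbhs_pinfty_gt.
  move=> x Sx; apply: le_trans (normc_le_parts _) _.
  have -> : e = e / 2 + e / 2 by field.
  have partE part : is_part part -> measurable_fun setT (fun x : borel N => part (a x)) ->
      part (laplace_radial k f a z x.1 x.2) = expR (- (z * f0)) * J part z x ->
      part (delta z x.1 x.2) = z `^ (d%:R / alpha x.1 x.2) * J part z x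
      - part (a x.1) * ((alpha x.1 x.2)^-1 * c x.1 x.2 `^ (- (d%:R / alpha x.1 x.2)) *
          gamma (d%:R / alpha x.1 x.2)).
    move=> [partM partB _] mpart lr.
    rewrite /delta partB mulrC partM lr /L partM; congr (_ - _).
    by rewrite /E mulrAC mulrA mulrAC -!mulrA mulrCA mulrA expK mul1r mulrC.
  apply: lerD.
    rewrite (partE _ Re_is_part mRe); last exact: (lrE _ _ _ Re_is_part mRe z0 Sx).
    by move: x Sx {partE}; near: z.
  rewrite (partE _ Im_is_part mIm); last exact: (lrE _ _ _ Im_is_part mIm z0 Sx).
  by move: x Sx {partE}; near: z.
split; first exact: lim.
exists delta; split; last exact: lim.
move=> z p z0 kp g.
have mdir := measurable_directions kp.
(* For fixed [z] the integrand is measurable and bounded in the direction, and the sphere has finite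
   measure. *)
have Jint part : is_part part -> measurable_fun setT (fun x : borel N => part (a x)) ->
    (sphere_measure R (codim k)).-integrable (directions k p)
      (fun theta => (J part z (p, theta))%:E).
  move=> ppart mpart; apply: measurable_bounded_integrable => //.
  - exact: sphere_measure_lty.
  - apply: (measurable_radial_integral (measurable_cell_ball kp)
      (H := fun s => part (a (nmap k p s)) * jac k p s * expR (- (z * (f (nmap k p s) - f0))))
      _ (fun r theta => @DS p theta r kp)) => //.
    apply: measurable_funM; first exact: mHG.
    apply: measurableT_comp => //; apply: measurableT_comp; first exact: oppr_measurable.
    by apply: measurable_funM => //; exact: mHphi.
  - exists (K * eps ^+ d.-1 * eps); split; first exact: num_real.
    move=> y Ky theta dt /=; apply: le_trans (ltW Ky).
    by have [] := JB part z (p, theta) ppart mpart z0 (conj kp dt).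
(* [L] cancels against its copy in [delta], and the opposite powers of [z] multiply to 1 because z >
   0. *)
have gE theta : directions k p theta ->
    g theta = (expR (z * f0))%:C * laplace_radial k f a z p theta.
  move=> dt; rewrite /g /delta addrC subrK mulrA -rmorphM /E /=.
  by rewrite mulrCA -powRD ?addNr ?powRr0 ?mulr1// (gt_eqF z0) implybT.
have gpart part : is_part part -> (forall theta, directions k p theta ->
      part (laplace_radial k f a z p theta) = expR (- (z * f0)) * J part z (p, theta)) ->
    {in directions k p, (fun theta => part (g theta)) =1 (fun theta => J part z (p, theta))}.
  move=> [partM _ _] lr theta; rewrite inE => dt.
  by rewrite gE// mulrC partM lr// mulrAC [_ * expR (z * f0)]mulrC expK mul1r.
have lrRe theta : directions k p theta ->
    complex.Re (laplace_radial k f a z p theta) = expR (- (z * f0)) * J (@complex.Re R) z (p, theta).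
  by move=> dt; exact: (lrE _ _ (p, theta) Re_is_part mRe z0 (conj kp dt)).
have lrIm theta : directions k p theta ->
    complex.Im (laplace_radial k f a z p theta) = expR (- (z * f0)) * J (@complex.Im R) z (p, theta).
  by move=> dt; exact: (lrE _ _ (p, theta) Im_is_part mIm z0 (conj kp dt)).
have gRe := gpart _ Re_is_part lrRe; have gIm := gpart _ Im_is_part lrIm.
split.
  split.
  - apply: eq_integrable (Jint _ Re_is_part mRe) => // theta dt.
    by congr EFin; rewrite gRe.
  - apply: eq_integrable (Jint _ Im_is_part mIm) => // theta dt.
    by congr EFin; rewrite gIm.
(* The factor e^(-z f0) does not depend on the direction and leaves the integral; [hpolar] then
   turns this into the formula for [laplace]. *)
have intE part : is_part part -> measurable_fun setT (fun x : borel N => part (a x)) ->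
    (forall theta, directions k p theta ->
      part (laplace_radial k f a z p theta) = expR (- (z * f0)) * J part z (p, theta)) ->
    \int[sphere_measure R (codim k)]_(theta in directions k p)
      part (laplace_radial k f a z p theta) =
    expR (- (z * f0)) *
      \int[sphere_measure R (codim k)]_(theta in directions k p) part (g theta).
  move=> ppart mpart lr.
  transitivity (\int[sphere_measure R (codim k)]_(theta in directions k p)
      (expR (- (z * f0)) * J part z (p, theta))).
    by apply: eq_Rintegral => theta; rewrite inE; exact: lr.
  rewrite RintegralZl//; last exact: Jint.
  by congr (_ * _); apply: eq_Rintegral => theta dt; rewrite (gpart part).
rewrite hpolar// /cintegral (intE _ Re_is_part mRe lrRe) (intE _ Im_is_part mIm lrIm).
by apply/eqP; rewrite eq_complex /= !mul0r subr0 addr0 !eqxx.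
Unshelve. all: by end_near. Qed.
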